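(* Assume that $\alpha_1>0$, $g\in C^3(\mathbb{R},\mathbb{R}^{2,2})$ and $g_1(0)<0$, and that there exists a traveling oscillating front of $u_t=Au_{xx}+f(u)$ with profile $v_\star\in C^2_b(\mathbb{R},\mathbb{R}^2)$, speed $c>0$, frequency $\omega\in\mathbb{R}$ and asymptotic rest-state $v_\infty=(|v_\infty|,0)^\top\in\mathbb{R}^2\setminus\{0\}$ such that $g_1'(|v_\infty|^2)<0$. Then $v_\star\in C^5_b(\mathbb{R},\mathbb{R}^2)$ and there are constants $K,\mu_\star>0$ such that $$|v_\star(x)-v_\infty|+|v_\star'(x)|+|v_\star''(x)|+|v_\star'''(x)|\le Ke^{-\mu_\star x}\quad\forall\,x\ge0,$$ $$|v_\star(x)|+|v_\star'(x)|+|v_\star''(x)|+|v_\star'''(x)|\le Ke^{\mu_\star x}\quad\forall\,x\le0.$$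
   Context: $\alpha=\alpha_1+i\alpha_2\in\mathbb{C}$, $g_1,g_2:\mathbb{R}\to\mathbb{R}$, $$A=\begin{pmatrix}\alpha_1&-\alpha_2\\ \alpha_2&\alpha_1\end{pmatrix},\quad g(\cdot)=\begin{pmatrix}g_1(\cdot)&-g_2(\cdot)\\ g_2(\cdot)&g_1(\cdot)\end{pmatrix},\quad f(u)=g(|u|^2)u\ (u\in\mathbb{R}^2),$$ $$R_\theta=\begin{pmatrix}\cos\theta&-\sin\theta\\ \sin\theta&\cos\theta\end{pmatrix},\quad S_\omega=\begin{pmatrix}0&-\omega\\ \omega&0\end{pmatrix}.$$ A traveling oscillating front of $u_t=Au_{xx}+f(u)$, $x\in\mathbb{R},t\ge0$, is a solution $u_\star(x,t)=R_{-\omega t}v_\star(x-ct)$ with $v_\star(\xi)\to0$ as $\xi\to-\infty$ and $v_\star(\xi)\to v_\infty\ne0$ as $\xi\to+\infty$; $v_\star$ is the profile, $c$ the speed, $\omega$ the frequency, $v_\infty$ the asymptotic rest-state. Thus $Av_\star''+cv_\star'+S_\omega v_\star+f(v_\star)=0$ on $\mathbb{R}$. $C^k_b$: $C^k$ functions that are bounded together with their derivatives up to order $k$. *)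

(* Defs.v *)
From mathcomp Require Export all_boot all_order all_algebra.
From mathcomp Require Export all_classical all_reals all_analysis.
Export Order.TTheory GRing.Theory Num.Theory.
Export numFieldNormedType.Exports.

Set Implicit Arguments.
Unset Strict Implicit.
Unset Printing Implicit Defensive.

Local Open Scope classical_set_scope.
Local Open Scope ring_scope.

(* Euclidean norm; the library norm on matrices is the maximum norm. *)
Definition enorm (R : realType) (n : nat) (v : 'cV[R]_n) : R :=
  Num.sqrt (\sum_(i < n) v i 0 ^+ 2).

(* The real 2 x 2 matrix of multiplication by a + i b. *)
Definition cplx_mx (R : realType) (a b : R) : 'M[R]_2 :=
  \matrix_(i < 2, j < 2)
    if i == j then a else if i == 0 then - b else b.

Definition rot (R : realType) (theta : R) : 'M[R]_2 :=
  cplx_mx (cos theta) (sin theta).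

Definition gmx (R : realType) (g1 g2 : R -> R) (s : R) : 'M[R]_2 :=
  cplx_mx (g1 s) (g2 s).

Definition nonlin (R : realType) (g1 g2 : R -> R) (u : 'cV[R]_2) : 'cV[R]_2 :=
  gmx g1 g2 (enorm u ^+ 2) *m u.

Definition Ck (R : realType) (V : normedModType R) (k : nat) (f : R -> V) :
    Prop :=
  (forall j : nat, (j < k)%N -> forall x : R, derivable (derive1n j f) x 1) /\
  continuous (derive1n k f).

Definition Ckb (R : realType) (V : normedModType R) (k : nat) (f : R -> V) :
    Prop :=
  Ck k f /\ forall j : nat, (j <= k)%N -> bounded_fun (derive1n j f).

(* Classical solutions of u_t = A u_xx + f(u) on x in R, t >= 0, for functions
   u x t given for all real t. *)
Definition is_solution (R : realType) (A : 'M[R]_2) (f : 'cV[R]_2 -> 'cV[R]_2)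
    (u : R -> R -> 'cV[R]_2) : Prop :=
  forall x t : R, 0 <= t ->
  [/\ derivable (u x) t 1,
      derivable (u^~ t) x 1,
      derivable (derive1 (u^~ t)) x 1 &
      derive1 (u x) t = A *m derive1n 2 (u^~ t) x + f (u x t)].

Definition traveling_oscillating_front (R : realType) (A : 'M[R]_2)
    (f : 'cV[R]_2 -> 'cV[R]_2) (v : R -> 'cV[R]_2) (c omega : R)
    (vinf : 'cV[R]_2) : Prop :=
  [/\ is_solution A f (fun x t => rot (- (omega * t)) *m v (x - c * t)),
      v x @[x --> -oo] --> (0 : 'cV[R]_2),
      v x @[x --> +oo] --> vinf &
      vinf != 0].

(* Main.v *)
Require Import Defs.
From mathcomp Require Import ring lra.

(* Identify the plane with C and put alpha = alpha_1 + i alpha_2, g = g_1 + i g_2;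
   the profile solves alpha v'' + c v' + (g(|v|^2) + i omega) v = 0.  Smoothness is
   a bootstrap on this equation, and v' tends to 0 at both ends because v converges
   and v'' is bounded.

   Exponential decay at both ends comes from quadratic Lyapunov functions: if
   Q' <= - d N, Q <= D N and N' >= - C N with Q, N tending to 0, then N decays
   exponentially.  At - infinity one takes N = |v|^2 + |v'|^2; pairing the equation
   with v shows that Re (alpha v' conj v) + c |v|^2 / 2 has derivative
   alpha_1 |v'|^2 - g_1(|v|^2) |v|^2, and g_1(0) < 0.  At + infinity the linearization
   has a zero eigenvalue coming from the rotations, which disappears in the
   invariants s = |v|^2 - |v_infinity|^2, p = Re (v' conj v), q = Im (v' conj v).
   They solve a three dimensional system whose linear part is hyperbolic because
   g_1'(|v_infinity|^2) < 0; this gives the decay of s and v', and v - v_infinity is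
   recovered by integrating v'. *)

Set Implicit Arguments.
Unset Strict Implicit.
Unset Printing Implicit Defensive.

Local Open Scope classical_set_scope.
Local Open Scope ring_scope.

(** * Derivatives and monotonicity *)

(* Unlike the class [is_derive], not subject to instance resolution. *)
Definition has_deriv (R : realType) (f : R -> R) (x a : R) : Prop :=
  is_derive x 1 f a.

Section Calculus.
Variable R : realType.
Implicit Types (f g df Q N dQ dN : R -> R) (x a b : R).

Lemma has_deriv_eq f x a b : has_deriv f x a -> a = b -> has_deriv f x b.
Proof. by move=> ? <-. Qed.

Lemma has_deriv_cst a x : has_deriv (fun=> a) x 0.
Proof. exact: is_derive_cst. Qed.

Lemma has_deriv_id x : has_deriv (fun y => y) x 1.
Proof. exact: is_derive_id. Qed.

Lemma has_derivD f g x a b : has_deriv f x a -> has_deriv g x b ->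
  has_deriv (fun y => f y + g y) x (a + b).
Proof. exact: is_deriveD. Qed.

Lemma has_derivN f x a : has_deriv f x a -> has_deriv (fun y => - f y) x (- a).
Proof. exact: is_deriveN. Qed.

Lemma has_derivM f g x a b : has_deriv f x a -> has_deriv g x b ->
  has_deriv (fun y => f y * g y) x (a * g x + f x * b).
Proof.
move=> fa gb; apply: has_deriv_eq; first exact: (is_deriveM fa gb).
by rewrite addrC [g x *: a]mulrC.
Qed.

Lemma has_deriv_comp f g x a b : has_deriv f (g x) a -> has_deriv g x b ->
  has_deriv (fun y => f (g y)) x (a * b).
Proof. exact: is_derive1_comp. Qed.

Lemma has_deriv_flip f x a : has_deriv f (- x) a ->
  has_deriv (fun y => f (- y)) x (- a).
Proof.
move=> fa; apply: has_deriv_eq.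
  by apply: (has_deriv_comp fa); apply: has_derivN; exact: has_deriv_id.
by rewrite mulrN1.
Qed.

Lemma derivable_has_deriv f x : derivable f x 1 -> has_deriv f x (derive1 f x).
Proof. by move=> ?; rewrite derive1E; exact: derivableP. Qed.

Lemma has_deriv_derivable f x a : has_deriv f x a -> derivable f x 1.
Proof. by case. Qed.

Lemma has_deriv_val f x a : has_deriv f x a -> derive1 f x = a.
Proof. by move=> H; rewrite derive1E; exact: derive_val. Qed.

Lemma has_deriv_continuous f x a : has_deriv f x a -> {for x, continuous f}.
Proof.
by move=> [fx _]; exact/differentiable_continuous/derivable1_diffP.
Qed.

Lemma mean_value f df a b : a <= b ->
    (forall x, a <= x <= b -> has_deriv f x (df x)) ->
  exists2 c, a <= c <= b & f b - f a = df c * (b - a).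
Proof.
move=> ab fdf; have [||c] := @MVT_segment R f df a b ab.
- by move=> x; rewrite in_itv /= => /andP[ax xb]; apply: fdf; rewrite !ltW.
- apply: derivable_within_continuous => x; rewrite in_itv /= => axb.
  by case: (fdf x axb).
- by rewrite in_itv /= => cab; exists c.
Qed.

Lemma derive1_le0_le f df a b : a <= b ->
    (forall x, a <= x -> has_deriv f x (df x)) ->
    (forall x, a <= x -> df x <= 0) ->
  f b <= f a.
Proof.
move=> ab fdf df0; have [|c /andP[ac _]] := mean_value ab (f := f) (df := df).
  by move=> x /andP[ax _]; exact: fdf.
by rewrite -subr_le0 => ->; rewrite mulr_le0_ge0 ?df0 ?subr_ge0.
Qed.

(** This is how quantities are compared at infinity: a difference of functions that tends to [0] has
    a sign as soon as its derivative has one. *)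
Lemma derive1_le0_lim f df a l :
    (forall x, a <= x -> has_deriv f x (df x)) ->
    (forall x, a <= x -> df x <= 0) ->
    f x @[x --> +oo] --> l ->
  forall x, a <= x -> l <= f x.
Proof.
move=> fdf df0 fl x ax; apply: (cvgr_to_le fl); near=> y.
apply: (@derive1_le0_le _ df) => [|z xz|z xz].
- by near: y; apply: nbhs_pinfty_ge; exact: num_real.
- by apply: fdf; exact: le_trans xz.
- by apply: df0; exact: le_trans xz.
Unshelve. all: by end_near. Qed.

Lemma pinfty_from (P : R -> Prop) : (\forall x \near +oo_R, P x) ->
  exists T, forall x, T <= x -> P x.
Proof.
(* The filter at infinity provides an open half-line; [M + 1] starts a closed one. *)
move=> [M [_ MP]]; exists (M + 1) => x Mx; apply: MP.
by rewrite (lt_le_trans _ Mx) // ltrDl.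
Qed.

Lemma from_pinfty (P : R -> Prop) T : (forall x, T <= x -> P x) ->
  \forall x \near +oo_R, P x.
Proof. by move=> TP; exists T; rewrite num_real; split => // x /ltW /TP. Qed.

End Calculus.

(** Derivatives are found from the shape of the expression, known ones being taken from the context
    first; [derive_ring] then identifies the value so obtained with the announced one. *)
Ltac derive_rules := repeat first
  [ eassumption
  | match goal with H : forall y, has_deriv ?f y _ |- has_deriv ?f _ _ => exact: H end
  | apply: has_deriv_cst | apply: has_derivD | apply: has_derivN
  | apply: has_derivM | apply: has_deriv_id ].
Ltac derive_ring := apply: has_deriv_eq; [derive_rules | cbv beta; ring].

(** * Exponential decay from a Lyapunov function *)

Section Decay.
Variable R : realType.
Implicit Types (f g df Q N dQ dN : R -> R) (x a b : R).

(** The constants are hidden and the bound is only asked near infinity, so that decay is stable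
    under algebraic operations; a bound on the whole half-line is recovered in
    [exp_decay_global]. *)
Definition exp_decay f := exists K mu : R,
  [/\ 0 < K, 0 < mu & \forall x \near +oo_R, `|f x| <= K * expR (- mu * x)].

(* [N] and [Q] are comparable: [N <= (C / d) Q] because [N - (C / d) Q] increases
   to [0]. *)
Lemma lyapunov_decay Q N dQ dN (C D d : R) : 0 < C -> 0 < D -> 0 < d ->
    (forall x, has_deriv Q x (dQ x)) -> (forall x, has_deriv N x (dN x)) ->
    (forall x, 0 <= N x) ->
    (\forall x \near +oo_R, - C * N x <= dN x) ->
    (\forall x \near +oo_R, dQ x <= - d * N x) ->
    (\forall x \near +oo_R, Q x <= D * N x) ->
    Q x @[x --> +oo] --> (0 : R) -> N x @[x --> +oo] --> (0 : R) ->
  exp_decay N.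
Proof.
move=> C0 D0 d0 Q' N' N0 dN_ge dQ_le QN Ql Nl.
have [T HT] : exists T, forall x, T <= x ->
    [/\ - C * N x <= dN x, dQ x <= - d * N x & Q x <= D * N x].
  by apply: pinfty_from; near=> x; split; near: x.
have N_le x : T <= x -> N x <= C / d * Q x.
  move=> Tx; rewrite -subr_ge0.
  have F' y : T <= y ->
      has_deriv (fun x => C / d * Q x - N x) y (C / d * dQ y - dN y).
    by move=> _; derive_ring.
  apply: (derive1_le0_lim F' _ _ Tx) => [y Ty|].
  - have [h1 h2 _] := HT y Ty.
    have : C / d * dQ y <= C / d * (- d * N y) by rewrite ler_wpM2l // divr_ge0 // ltW.
    have -> : C / d * (- d * N y) = - C * N y by field; rewrite gt_eqF.
    lra.
  - rewrite -[0](subr0 0) -[X in X - 0](mulr0 (C / d)).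
    by apply: cvgB => //; apply: cvgM => //; exact: cvg_cst.
(* The decay rate of [Q]: as [mu * Q <= d * N], the derivative of [Q] is at most [- mu * Q], so that
   [Q x * expR (mu * x)] is nonincreasing. *)
pose mu := d / D.
have mu0 : 0 < mu by rewrite divr_gt0.
have Qexp x : T <= x -> Q x * expR (mu * x) <= Q T * expR (mu * T).
  move=> Tx; have F' y : T <= y ->
      has_deriv (fun x => Q x * expR (mu * x)) y ((dQ y + mu * Q y) * expR (mu * y)).
    move=> _; have E : has_deriv (fun x => expR (mu * x)) y (expR (mu * y) * (0 * y + mu * 1)).
      by apply: has_deriv_comp; [exact: is_derive_expR | derive_rules].
    by derive_ring.
  apply: (derive1_le0_le Tx F') => y Ty.
    have [_ h1 h2] := HT y Ty.
    rewrite mulr_le0_ge0 ?expR_ge0 //.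
    have : mu * Q y <= mu * (D * N y) by rewrite ler_wpM2l // ltW.
    have -> : mu * (D * N y) = d * N y by rewrite /mu; field; rewrite gt_eqF.
    lra.
(* The added [1] keeps the constant positive even when [Q T] vanishes. *)
exists (C / d * `|Q T * expR (mu * T)| + 1), mu; split => //.
  by rewrite ltr_wpDl // mulr_ge0 // divr_ge0 // ltW.
apply: (@from_pinfty _ _ T) => x Tx.
rewrite ger0_norm // (le_trans (N_le x Tx)) //.
have e0 := expR_gt0 (mu * x).
rewrite mulNr expRN ler_pdivlMr // -[X in X <= _]mulrA.
apply: (@le_trans _ _ (C / d * `|Q T * expR (mu * T)|)); last by rewrite lerDl.
by rewrite ler_pM2l ?divr_gt0 // (le_trans (Qexp x Tx)) // ler_norm.
Unshelve. all: by end_near. Qed.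

End Decay.

(** * Exponentially decaying functions *)

Section DecayCalculus.
Variable R : realType.
Implicit Types (f g h df : R -> R) (x l C : R).

Lemma exp_decay_le f g C : exp_decay g ->
  (\forall x \near +oo_R, `|f x| <= C * `|g x|) -> exp_decay f.
Proof.
move=> [K [mu [K0 mu0 gK]]] fg; exists ((`|C| + 1) * K), mu; split => //.
  by rewrite mulr_gt0 // ltr_wpDl.
near=> x; have gx : `|g x| <= K * expR (- mu * x) by near: x.
have fx : `|f x| <= C * `|g x| by near: x.
rewrite -mulrA; apply: (le_trans fx).
apply: (@le_trans _ _ ((`|C| + 1) * `|g x|)); last by rewrite ler_pM2l // ltr_wpDl.
by rewrite ler_wpM2r // (le_trans (ler_norm _)) // lerDl.
Unshelve. all: by end_near. Qed.

Lemma exp_decayD f g : exp_decay f -> exp_decay g -> exp_decay (fun x => f x + g x).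
Proof.
move=> [K [mu [K0 mu0 fK]]] [L [nu [L0 nu0 gL]]].
exists (K + L), (Num.min mu nu); split; [by rewrite addr_gt0 | by rewrite lt_min mu0|].
(* For [x >= 0] the smaller of the two rates gives the larger exponential. *)
near=> x; have x0 : 0 <= x by near: x; apply: nbhs_pinfty_ge; exact: num_real.
rewrite (le_trans (ler_normD _ _)) // mulrDl lerD //.
- apply: (@le_trans _ _ (K * expR (- mu * x))); first by near: x.
  by rewrite ler_pM2l // ler_expR !mulNr lerN2 ler_wpM2r // ge_min lexx.
- apply: (@le_trans _ _ (L * expR (- nu * x))); first by near: x.
  by rewrite ler_pM2l // ler_expR !mulNr lerN2 ler_wpM2r // ge_min lexx orbT.
Unshelve. all: by end_near. Qed.

Lemma exp_decayM f g C : (forall x, `|f x| <= C) -> exp_decay g ->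
  exp_decay (fun x => f x * g x).
Proof.
move=> fC eg; apply: (@exp_decay_le _ _ C eg); near=> x.
by rewrite normrM ler_wpM2r.
Unshelve. all: by end_near. Qed.

Lemma exp_decay_cstM a f : exp_decay f -> exp_decay (fun x => a * f x).
Proof. exact: (@exp_decayM (fun=> a) f `|a|). Qed.

Lemma exp_decayN f : exp_decay f -> exp_decay (fun x => - f x).
Proof.
by move=> ef; apply: (exp_decay_le (C := 1) ef); near=> x; rewrite mul1r normrN.
Unshelve. all: by end_near. Qed.

Lemma exp_decay_norm f : exp_decay f -> exp_decay (fun x => `|f x|).
Proof.
by move=> ef; apply: (exp_decay_le (C := 1) ef); near=> x; rewrite mul1r normr_id.
Unshelve. all: by end_near. Qed.

(** Decay of a quadratic Lyapunov quantity passes to its components at half the rate. *)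
Lemma exp_decay_sqrt f g : exp_decay g ->
  (\forall x \near +oo_R, f x * f x <= g x) -> exp_decay f.
Proof.
move=> [K [mu [K0 mu0 gK]]] fg; exists (Num.sqrt K), (mu / 2); split.
- by rewrite sqrtr_gt0.
- by rewrite divr_gt0.
near=> x; rewrite -(@ler_pXn2r _ 2) ?nnegrE // ?mulr_ge0 ?sqrtr_ge0 ?expR_ge0 //.
rewrite exprMn sqr_sqrtr ?(ltW K0) // expr2 -normrM ger0_norm; last first.
  by rewrite -expr2 sqr_ge0.
rewrite -expRM_natl (_ : 2%:R * (- (mu / 2) * x) = - mu * x); last by field.
have fgx : f x * f x <= g x by near: x.
by rewrite (le_trans fgx) // (le_trans (ler_norm _)) //; near: x.
Unshelve. all: by end_near. Qed.

Lemma cvg_expN (mu : R) : 0 < mu -> expR (- mu * x) @[x --> +oo] --> (0 : R).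
Proof.
move=> mu0; apply/cvgrPdist_le => e e0; near=> x.
rewrite sub0r normrN ger0_norm ?expR_ge0 //.
(* Beyond this point [e^-1 <= mu * x <= expR (mu * x)], because [1 + y <= expR y]. *)
have x0 : e^-1 / mu <= x by near: x; apply: nbhs_pinfty_ge; exact: num_real.
rewrite mulNr expRN -(invrK e) lef_pV2 ?posrE ?invr_gt0 ?expR_gt0 //.
apply: (@le_trans _ _ (mu * x)); first by rewrite mulrC -ler_pdivrMr.
by apply: le_trans (expR_ge1Dx _); rewrite lerDr.
Unshelve. all: by end_near. Qed.

(** This replaces the integral of [df] up to infinity: adding the primitive
    [K / mu * expR (- mu * x)] to [f], or to [- f], makes it nonincreasing without changing its
    limit. *)
Lemma exp_decay_sub_lim f df l : (forall x, has_deriv f x (df x)) ->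
  exp_decay df -> f x @[x --> +oo] --> l -> exp_decay (fun x => f x - l).
Proof.
move=> fdf [K [mu [K0 mu0 dfK]]] fl.
have [T HT] := pinfty_from dfK.
have E y : has_deriv (fun x => expR (- mu * x)) y (expR (- mu * y) * (0 * y + - mu * 1)).
  by apply: has_deriv_comp; [exact: is_derive_expR | derive_rules].
have half h dh m : (forall x, has_deriv h x (dh x)) ->
    (forall x, T <= x -> `|dh x| <= K * expR (- mu * x)) ->
    h x @[x --> +oo] --> m ->
    forall x, T <= x -> m - h x <= K / mu * expR (- mu * x).
  move=> hdh dhK hm x Tx; rewrite lerBlDl.
  have F' y : T <= y -> has_deriv (fun x => h x + K / mu * expR (- mu * x)) y
      (dh y - K * expR (- mu * y)).
    move=> _; apply: has_deriv_eq; first by derive_rules.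
    by cbv beta; field; rewrite gt_eqF.
  apply: (derive1_le0_lim F' _ _ Tx) => [y Ty|].
    by rewrite subr_le0 (le_trans (ler_norm _)) // dhK.
  rewrite -[m]addr0 -[X in m + X](mulr0 (K / mu)).
  by apply: cvgD => //; apply: cvgM; [exact: cvg_cst | exact: cvg_expN].
exists (K / mu), mu; split => //; first by rewrite divr_gt0.
apply: (from_pinfty (T := T)) => x Tx; rewrite ler_norml; apply/andP; split.
- by rewrite lerNl opprB (half f df).
- have := half (fun x => - f x) (fun x => - df x) (- l) _ _ _ x Tx.
  rewrite opprK addrC; apply => [y|y Ty|].
  + by derive_rules.
  + by rewrite normrN HT.
  + exact: cvgN.
Unshelve. all: by end_near. Qed.

Lemma exp_decay_global f B : exp_decay f -> (forall x, `|f x| <= B) ->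
  exists K mu : R, [/\ 0 < K, 0 < mu &
    forall x, 0 <= x -> `|f x| <= K * expR (- mu * x)].
Proof.
move=> [K [mu [K0 mu0 /pinfty_from[T HT]]]] fB.
(* On [[0, T)] the exponential is at least [expR (- mu * |T|)], so the second summand covers the
   bound [B] there. *)
exists (K + `|B| * expR (mu * `|T|)), mu; split => //.
  by rewrite ltr_pwDl // mulr_ge0 // expR_ge0.
move=> x x0; have e0 := expR_ge0 (- mu * x); rewrite mulrDl; have [Tx|xT] := leP T x.
  by rewrite (le_trans (HT x Tx)) // lerDl !mulr_ge0 ?expR_ge0.
rewrite (le_trans (fB x)) // (le_trans (ler_norm B)) // ler_wpDl ?mulr_ge0 ?(ltW K0) //.
rewrite -mulrA -expRD ler_peMr // -[leLHS]expR0 ler_expR.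
rewrite mulNr -mulrBr mulr_ge0 ?(ltW mu0) // subr_ge0.
by rewrite (le_trans (ltW xT)) // ler_norm.
Qed.

(** Over an interval of length [d] the mean of [g] is small because [f] converges, while [g] itself
    varies by at most [C * d]. *)
Lemma deriv_cvg0 f g h l C :
    (forall x, has_deriv f x (g x)) -> (forall x, has_deriv g x (h x)) ->
    (forall x, `|h x| <= C) -> f x @[x --> +oo] --> l ->
  g x @[x --> +oo] --> (0 : R).
Proof.
move=> fg gh hC fl; apply/cvgrPdist_le => e e0.
have C0 : 0 <= C by rewrite (le_trans _ (hC 0)).
(* With this [d] the variation of [g] is at most [e / 2]. The threshold [d * e / 4] below, used at
   both end points, yields the other [e / 2]. *)
pose d := e / (2 * (C + 1)).
have C1 : 0 < C + 1 by rewrite ltr_wpDl.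
have d0 : 0 < d by rewrite divr_gt0 // mulr_gt0.
have de0 : 0 < d * e / 4 by rewrite divr_gt0 // mulr_gt0.
have [T HT] := pinfty_from (cvgr_dist_le _ _ fl _ de0).
apply: (from_pinfty (T := T)) => x Tx; rewrite sub0r normrN.
have xd : x <= x + d by rewrite lerDl ltW.
have [y /andP[xy yd]] := mean_value xd (fun z _ => fg z).
rewrite [x + d]addrC addrK => Ey.
have [z _ Ez] := mean_value xy (fun z _ => gh z).
have gy : `|g y| <= e / 2.
  rewrite -(ler_pM2r d0) -[X in _ * X](ger0_norm (ltW d0)) -normrM -Ey.
  have -> : f (d + x) - f x = (l - f x) - (l - f (d + x)) by ring.
  have := ler_normB (l - f x) (l - f (d + x)).
  have := HT x Tx; have := HT (d + x); rewrite addrC => /(_ (le_trans Tx xd)).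
  lra.
have gxy : `|g y - g x| <= e / 2.
  rewrite Ez normrM; apply: (@le_trans _ _ ((C + 1) * d)).
    rewrite ler_pM //; first by rewrite (le_trans (hC z)) // lerDl.
    by rewrite ger0_norm ?subr_ge0 // lerBlDl.
  by rewrite /d le_eqVlt; apply/orP; left; apply/eqP; field; rewrite gt_eqF.
have -> : g x = g y - (g y - g x) by ring.
by have := ler_normB (g y) (g y - g x); lra.
Qed.

(** Over an interval of length one [f] increases by a value of [g], which is close to [m], whereas
    the increase tends to [0]. *)
Lemma lim_deriv_eq0 f g l m : (forall x, has_deriv f x (g x)) ->
  f x @[x --> +oo] --> l -> g x @[x --> +oo] --> m -> m = 0.
Proof.
move=> fg fl gm; apply/eqP; rewrite -normr_le0; apply/ler_addgt0Pl => e e0.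
have e40 : 0 < e / 4 by rewrite divr_gt0.
have [T HT] := pinfty_from (cvgr_dist_le _ _ fl _ e40).
have [S HS] := pinfty_from (cvgr_dist_le _ _ gm _ e40).
pose x := Num.max T S; have Tx : T <= x by rewrite le_max lexx.
have Sx : S <= x by rewrite le_max lexx orbT.
have x1 : x <= x + 1 by rewrite lerDl.
have [y /andP[xy _]] := mean_value x1 (fun z _ => fg z).
rewrite [x + 1]addrC addrK mulr1 => Ey.
have := HT x Tx; have := HT (1 + x); rewrite addrC => /(_ (le_trans Tx x1)).
have := HS y (le_trans Sx xy); rewrite -Ey [x + 1]addrC.
move=> /ler_normlP [? ?] /ler_normlP [? ?] /ler_normlP [? ?].
by rewrite addr0; apply/ler_normlP; split; lra.
Qed.

End DecayCalculus.

(** * Decay for perturbed hyperbolic systems *)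

Section Hyperbolic.
Variable R : realType.

(** Each monomial is at most the sum of squares in absolute value; for the mixed ones, expand the
    squares of sums and differences. *)
Lemma quadratic_form_bound (c1 c2 c3 c4 c5 c6 x y z : R) :
  `|c1 * (x * x) + c2 * (y * y) + c3 * (z * z) + c4 * (x * y) + c5 * (x * z) + c6 * (y * z)|
  <= (`|c1| + `|c2| + `|c3| + `|c4| + `|c5| + `|c6|) * (x * x + y * y + z * z).
Proof.
have H (a c t : R) : `|t| <= a -> `|c * t| <= `|c| * a.
  by move=> ta; rewrite normrM ler_wpM2l.
set N := x * x + y * y + z * z.
have sq (t : R) : 0 <= t * t by rewrite -expr2 sqr_ge0.
have [[x0 y0] z0] := (sq x, sq y, sq z).
have [[xy xz] yz] := (sq (x + y), sq (x + z), sq (y + z)).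
have [[xy' xz'] yz'] := (sq (x - y), sq (x - z), sq (y - z)).
have B t : - N <= t -> t <= N -> `|t| <= N by move=> ? ?; apply/ler_normlP; split; lra.
have T (a b a' b' : R) : `|a| <= a' -> `|b| <= b' -> `|a + b| <= a' + b'.
  by move=> aa' bb'; rewrite (le_trans (ler_normD _ _)) // lerD.
rewrite !mulrDl; do 5! [apply: (T); last by apply: H; apply: B; rewrite /N; lra].
by apply: H; apply: B; rewrite /N; lra.
Qed.

(* The weight [mu] of [q ^ 2] must be small for the cross terms to be absorbed. *)
Lemma hyperbolic_form_le (k l e1 e2 : R) : 0 < k -> 0 < k * e1 + l * e2 ->
  exists mu kappa : R, [/\ 0 < mu, 0 < kappa & forall s p q t : R,
    mu * q * (- k * q - l * p + e2 * s)
    - ((k * e1 + l * e2) * (s * s)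
       + 2 * (2 * k + (k * e1 + l * e2)) * (p * p) + 2 * k * (t * t))
    <= - kappa * (s * s + p * p + q * q)].
Proof.
move=> k0; set B := k * e1 + l * e2 => B0.
(* Absorbing the cross term will cost [t * (s * s + p * p)]; with [t] below [B / 2] and [k], at
   least [t] is left in both coefficients. *)
pose t := Num.min (B / 2) k.
have t0 : 0 < t by rewrite lt_min divr_gt0 //.
have tB : t <= B / 2 by rewrite ge_min lexx.
have tk : t <= k by rewrite ge_min lexx orbT.
(* For the linear form [X] below, [X * X <= 2 * m * (s * s + p * p)]; the choice [mu = k * t / m]
   then turns the remainder [mu / (2 * k) * (X * X)] of Young's inequality into at most
   [t * (s * s + p * p)]. *)
pose m := 1 + l * l + e2 * e2.
have sq (u : R) : 0 <= u * u by rewrite -expr2 sqr_ge0.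
have m1 : 1 <= m by have := sq l; have := sq e2; rewrite /m; lra.
have m0 : 0 < m by lra.
pose mu := k * t / m; exists mu.
have mu0 : 0 < mu by rewrite divr_gt0 // mulr_gt0.
have muk0 : 0 < mu * k / 2 by rewrite divr_gt0 // mulr_gt0.
exists (Num.min (mu * k / 2) t); split => //; first by rewrite lt_min muk0.
move=> s p q u.
set ka := Num.min _ _.
have ka1 : ka <= mu * k / 2 by rewrite ge_min lexx.
have ka2 : ka <= t by rewrite ge_min lexx orbT.
have Emu : mu * m = k * t by rewrite /mu; field; rewrite gt_eqF.
pose X := e2 * s - l * p.
(* Young's inequality, from the square of [k * q - X]. *)
have h1 : mu * (q * X) <= mu * k / 2 * (q * q) + t / (2 * m) * (X * X).
  have : 0 <= mu / (2 * k) * ((k * q - X) * (k * q - X)).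
    by rewrite mulr_ge0 ?sq // ltW // divr_gt0 // mulr_gt0.
  have -> : mu / (2 * k) * ((k * q - X) * (k * q - X)) =
     mu * k / 2 * (q * q) - mu * (q * X) + t / (2 * m) * (X * X).
    by rewrite /mu; field; rewrite !gt_eqF.
  lra.
have h2 : X * X <= 2 * m * (s * s + p * p).
  have := sq (e2 * s + l * p); have := sq (e2 * p); have := sq (l * s).
  by have := sq s; have := sq p; rewrite /X /m; nra.
have h3 : t / (2 * m) * (X * X) <= t * (s * s + p * p).
  have -> : t * (s * s + p * p) = t / (2 * m) * (2 * m * (s * s + p * p)).
    by field; rewrite gt_eqF.
  by rewrite ler_wpM2l // ltW // divr_gt0 // mulr_gt0.
have hq : ka * (q * q) <= mu * k / 2 * (q * q) by rewrite ler_wpM2r ?sq.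
have hs : ka * (s * s) <= t * (s * s) by rewrite ler_wpM2r ?sq.
have hp : ka * (p * p) <= t * (p * p) by rewrite ler_wpM2r ?sq.
have hs' : t * (s * s) <= B / 2 * (s * s) by rewrite ler_wpM2r ?sq.
have hp' : t * (p * p) <= k * (p * p) by rewrite ler_wpM2r ?sq.
have hB : 0 <= B * (p * p) by rewrite mulr_ge0 ?sq // ltW.
have hk : 0 <= k * (p * p) by rewrite mulr_ge0 ?sq // ltW.
have hu : 0 <= k * (u * u) by rewrite mulr_ge0 ?sq // ltW.
have -> : mu * q * (- k * q - l * p + e2 * s) = - (mu * k * (q * q)) + mu * (q * X).
  by rewrite /X; ring.
lra.
Qed.

Lemma linear_form_bound (c1 c2 c3 x y z : R) :
  `|c1 * x + c2 * y + c3 * z| <= (`|c1| + `|c2| + `|c3|) * (`|x| + `|y| + `|z|).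
Proof.
have := ler_normD (c1 * x + c2 * y) (c3 * z); have := ler_normD (c1 * x) (c2 * y).
rewrite !normrM; have := normr_ge0 c1; have := normr_ge0 c2; have := normr_ge0 c3.
have := normr_ge0 x; have := normr_ge0 y; have := normr_ge0 z.
nra.
Qed.

Lemma sqr_sum3_le (x y z : R) :
  (`|x| + `|y| + `|z|) * (`|x| + `|y| + `|z|) <= 3 * (x * x + y * y + z * z).
Proof.
have N2 (t : R) : t * t = `|t| * `|t| by rewrite -normrM ger0_norm // -expr2 sqr_ge0.
rewrite (N2 x) (N2 y) (N2 z).
have sq (t : R) : 0 <= t * t by rewrite -expr2 sqr_ge0.
have := sq (`|x| - `|y|); have := sq (`|x| - `|z|); have := sq (`|y| - `|z|).
nra.
Qed.
End Hyperbolic.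

Section HyperbolicDecay.
Variable R : realType.

(* With [ell] the linear part of [p'], the linear part of the system is the third
   order equation [ell' = - 2 k ell + b1 p + b0 s]; testing it against [s] and
   [ell] gives a quadratic form [L] with definite derivative
   [b0 s ^ 2 + 2 (2 k + b0) p ^ 2 + 2 k ell ^ 2]. *)
Lemma hyperbolic_decay (k l e1 e2 : R) (s p q h1 h2 : R -> R) :
    0 < k -> 0 < k * e1 + l * e2 ->
    (forall x, has_deriv s x (2 * p x)) ->
    (forall x, has_deriv p x (- k * p x + l * q x + e1 * s x + h1 x)) ->
    (forall x, has_deriv q x (- k * q x - l * p x + e2 * s x + h2 x)) ->
    (forall e : R, 0 < e ->
       \forall x \near +oo_R, `|h1 x| <= e * (`|s x| + `|p x| + `|q x|)) ->
    (forall e : R, 0 < e ->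
       \forall x \near +oo_R, `|h2 x| <= e * (`|s x| + `|p x| + `|q x|)) ->
    s x @[x --> +oo] --> (0 : R) -> p x @[x --> +oo] --> (0 : R) ->
    q x @[x --> +oo] --> (0 : R) ->
  exp_decay (fun x => s x * s x + p x * p x + q x * q x).
Proof.
move=> k0; set b0 := k * e1 + l * e2 => b00 s' p' q' h1o h2o s0 p0 q0.
have [mu [ka [mu0 ka0 form]]] := hyperbolic_form_le k0 b00.
pose b1 : R := 2 * e1 - (k * k + l * l).
pose ell (x : R) : R := - k * p x + l * q x + e1 * s x.
pose L (x : R) : R := s x * ell x - p x * p x + 2 * k * s x * p x - b1 / 4 * (s x * s x)
  - ell x * ell x / 2 + b1 / 2 * (p x * p x) + b0 * s x * p x.
pose Q (x : R) : R := mu / 2 * (q x * q x) - L x.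
pose N (x : R) : R := s x * s x + p x * p x + q x * q x.
(* [X] and [Y] are the partial derivatives of [L] in [p] and in [ell]. The perturbation enters [p']
   as [h1] and [ell'] as [- k * h1 + l * h2], which gives the last line of [dQ]. *)
pose X (x : R) : R := - 2 * p x + 2 * k * s x + b1 * p x + b0 * s x.
pose Y (x : R) : R := s x - ell x.
pose dQ (x : R) : R := mu * q x * (- k * q x - l * p x + e2 * s x)
    - (b0 * (s x * s x) + 2 * (2 * k + b0) * (p x * p x) + 2 * k * (ell x * ell x))
    + (h1 x * (k * Y x - X x) + h2 x * (mu * q x - l * Y x)).
pose dN (x : R) : R := 2 * (s x * (2 * p x) + p x * (- k * p x + l * q x + e1 * s x + h1 x)
   + q x * (- k * q x - l * p x + e2 * s x + h2 x)).
have N' x : has_deriv N x (dN x) by rewrite /N /dN; derive_ring.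
have Q' x : has_deriv Q x (dQ x).
  rewrite /Q /L /ell /dQ /Y /X /ell /b1 /b0; apply: has_deriv_eq; first by derive_rules.
  by cbv beta; field.
have sq (u : R) : 0 <= u * u by rewrite -expr2 sqr_ge0.
have N0 x : 0 <= N x by rewrite /N !addr_ge0.
pose n (x : R) : R := `|s x| + `|p x| + `|q x|.
have n0 x : 0 <= n x by rewrite /n !addr_ge0.
have nN x : n x * n x <= 3 * N x by exact: sqr_sum3_le.
(* A perturbation that is small against [n], times a linear form, is small against [N], since [n]
   squared is at most [3 * N]. *)
have small (h y : R -> R) (e M : R) : 0 <= M -> 0 <= e -> 
   (forall x, `|y x| <= M * n x) ->
   forall x, `|h x| <= e * n x -> `|h x * y x| <= 3 * (e * M) * N x.
  move=> M0 e0 yM x hx.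
  have eM : 0 <= e * M by rewrite mulr_ge0.
  have := ler_wpM2l eM (nN x).
  have : `|h x * y x| <= e * n x * (M * n x) by rewrite normrM ler_pM.
  nra.
have kYX : exists2 M, 0 <= M & forall x, `|k * Y x - X x| <= M * n x.
  exists (`|k - k * e1 - 2 * k - b0| + `|k * k + 2 - b1| + `|- k * l|).
    by rewrite !addr_ge0.
  move=> x; rewrite (_ : k * Y x - X x = (k - k * e1 - 2 * k - b0) * s x +
    (k * k + 2 - b1) * p x + - k * l * q x); last by rewrite /Y /X /ell; ring.
  exact: linear_form_bound.
have mlY : exists2 M, 0 <= M & forall x, `|mu * q x - l * Y x| <= M * n x.
  exists (`|l * e1 - l| + `|- l * k| + `|mu + l * l|).
    by rewrite !addr_ge0.
  move=> x; rewrite (_ : mu * q x - l * Y x = (l * e1 - l) * s x +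
    - l * k * p x + (mu + l * l) * q x); last by rewrite /Y /ell; ring.
  exact: linear_form_bound.
have [M1 M10 M1P] := kYX; have [M2 M20 M2P] := mlY.
(* Once [ell] is expanded, [Q] is a quadratic form in [s], [p], [q]; unification reads [D] off its
   coefficients. *)
have [D QD] : exists D, forall x, `|Q x| <= D * N x.
  eexists => x; rewrite (_ : Q x =
       (- (e1 - b1 / 4 - e1 * e1 / 2)) * (s x * s x)
       + (- (- 1 - k * k / 2 + b1 / 2)) * (p x * p x)
       + (mu / 2 + l * l / 2) * (q x * q x)
       + (- (k + k * e1 + b0)) * (s x * p x)
       + (- (l - l * e1)) * (s x * q x)
       + (- (k * l)) * (p x * q x)).
    exact: quadratic_form_bound.
  by rewrite /Q /L /ell; field.
(* Chosen so that the perturbation [3 * e * (M1 + M2) * N] consumes at most half of the definite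
   term [ka * N]. *)
pose e : R := ka / (6 * (M1 + M2 + 1)).
have M0 : 0 < M1 + M2 + 1 by lra.
have e0 : 0 < e by rewrite divr_gt0 // mulr_gt0.
(* Coefficients of half the linear part of [dN]: there is no [s * s] term and the [p * q] terms
   cancel. The terms [h1 * p] and [h2 * q] add [3 * N] each, whence the constant
   [2 * (dNc + 3 + 3)]. *)
pose dNc : R := `|0 : R| + `|- k| + `|- k| + `|2 + e1| + `|e2| + `|l - l|.
have dNc0 : 0 <= dNc by rewrite /dNc !addr_ge0.
have Nl : N x @[x --> +oo] --> (0 : R).
  have -> : 0 = 0 * 0 + 0 * 0 + 0 * 0 :> R by rewrite !mulr0 !addr0.
  by apply: cvgD; [apply: cvgD|]; apply: cvgM.
refine (@lyapunov_decay _ Q N dQ dN (2 * (dNc + 3 + 3)) (`|D| + 1) (ka / 2)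
  _ _ _ _ _ _ _ _ _ _ _) => //.
- lra.
- by rewrite divr_gt0.
- move: (h1o 1 ltr01) (h2o 1 ltr01); apply: filterS2 => x a1 a2.
  have pn (y : R) : `|p y| <= 1 * n y by rewrite mul1r /n -addrA addrCA lerDl addr_ge0.
  have qn (y : R) : `|q y| <= 1 * n y by rewrite mul1r /n lerDr addr_ge0.
  have /ler_normlP[H1 _] := small h1 p 1 1 ler01 ler01 pn x a1.
  have /ler_normlP[H2 _] := small h2 q 1 1 ler01 ler01 qn x a2.
  have := quadratic_form_bound 0 (- k) (- k) (2 + e1) e2 (l - l) (s x) (p x) (q x).
  rewrite -/dNc => /ler_normlP[H3 _].
  by move: H1 H2 H3; rewrite -/(N x) /dN; lra.
- move: (h1o e e0) (h2o e e0); apply: filterS2 => x a1 a2.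
  have /ler_normlP[_ H1] := small _ _ _ _ M10 (ltW e0) M1P x a1.
  have /ler_normlP[_ H2] := small _ _ _ _ M20 (ltW e0) M2P x a2.
  have H3 := form (s x) (p x) (q x) (ell x).
  have E : 3 * (e * M1) * N x + 3 * (e * M2) * N x <= ka / 2 * N x.
    rewrite -mulrDl ler_wpM2r //.
    have -> : ka / 2 = 3 * (e * (M1 + M2 + 1)) by rewrite /e; field; rewrite gt_eqF.
    by have := ltW e0; lra.
  by move: H1 H2 H3 E; rewrite /dQ -/(N x) -/b0; lra.
- apply: nearW => x; rewrite (le_trans (ler_norm _)) // (le_trans (QD x)) // ler_wpM2r //.
  by rewrite (le_trans (ler_norm _)) // lerDl.
- apply/norm_cvg0P; apply: (squeeze_cvgr (f := fun=> 0) (h := fun x => D * N x)).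
  + by apply: nearW => x; rewrite normr_ge0 QD.
  + exact: cvg_cst.
  + by rewrite -[0](mulr0 D); apply: cvgM => //; exact: cvg_cst.
Qed.
End HyperbolicDecay.

(** * The profile equation near its two ends *)

Section Ends.
Variable R : realType.
Variables (a1 a2 c : R) (v1 v2 w1 w2 z1 z2 G1 G2 : R -> R).
Hypothesis a10 : 0 < a1.
Hypothesis v1' : forall x, has_deriv v1 x (w1 x).
Hypothesis v2' : forall x, has_deriv v2 x (w2 x).
Hypothesis w1' : forall x, has_deriv w1 x (z1 x).
Hypothesis w2' : forall x, has_deriv w2 x (z2 x).
(** [F1 + i F2] is [c v' + G v], and the equations below read [v'' = - a (c v' + G v)] with
    [a = a1 + i a2]. Keeping [G1] and [G2] as plain functions of [x] lets the section serve both
    ends, the left one after a reflection. *)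
Let F1 x := c * w1 x + (G1 x * v1 x - G2 x * v2 x).
Let F2 x := c * w2 x + (G2 x * v1 x + G1 x * v2 x).
Hypothesis ode1 : forall x, z1 x = - (a1 * F1 x - a2 * F2 x).
Hypothesis ode2 : forall x, z2 x = - (a2 * F1 x + a1 * F2 x).

(* [a = 1 / alpha]; the monotone quantity is multiplied by [|a| ^ 2]. *)
Lemma energy_decay (C ga : R) : 0 < ga ->
    (forall x, `|G1 x| <= C) -> (forall x, `|G2 x| <= C) ->
    (\forall x \near +oo_R, G1 x <= - ga) ->
    v1 x @[x --> +oo] --> (0 : R) -> v2 x @[x --> +oo] --> (0 : R) ->
    w1 x @[x --> +oo] --> (0 : R) -> w2 x @[x --> +oo] --> (0 : R) ->
  exp_decay (fun x => v1 x * v1 x + v2 x * v2 x + w1 x * w1 x + w2 x * w2 x).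
Proof.
move=> ga0 G1C G2C G1ga v10 v20 w10 w20.
pose aa : R := a1 * a1 + a2 * a2.
have aa0 : 0 < aa by rewrite ltr_pwDl ?mulr_gt0 // -expr2 sqr_ge0.
pose N (x : R) : R := v1 x * v1 x + v2 x * v2 x + w1 x * w1 x + w2 x * w2 x.
(* [|a| ^ 2 * alpha] is the conjugate of [a], so the scaled energy has the coefficients [a1] and
   [a2]; the minus sign makes it decrease. *)
pose Q (x : R) : R := - (a1 * (v1 x * w1 x + v2 x * w2 x)
  + a2 * (v1 x * w2 x - v2 x * w1 x) + aa * c / 2 * (v1 x * v1 x + v2 x * v2 x)).
pose dQ (x : R) : R := - (a1 * (w1 x * w1 x + w2 x * w2 x)
  - aa * G1 x * (v1 x * v1 x + v2 x * v2 x)).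
pose dN (x : R) : R := 2 * (v1 x * w1 x + v2 x * w2 x + w1 x * z1 x + w2 x * z2 x).
have N' x : has_deriv N x (dN x) by rewrite /N /dN; derive_ring.
have Q' x : has_deriv Q x (dQ x).
  rewrite /Q /dQ; apply: has_deriv_eq; first by derive_rules.
  by cbv beta; rewrite ode1 ode2 /F1 /F2 /aa; field.
have sq (u : R) : 0 <= u * u by rewrite -expr2 sqr_ge0.
have N0 x : 0 <= N x by rewrite /N !addr_ge0.
have C0 : 0 <= C by rewrite (le_trans _ (G1C 0)).
have ab (M u v x : R) : 0 <= M -> u * u <= N x -> v * v <= N x -> M * `|u * v| <= M * N x.
  move=> M0 uN vN; rewrite ler_wpM2l //; apply/ler_normlP.
  by have := sq (u - v); have := sq (u + v); split; lra.
have vN x : [/\ v1 x * v1 x <= N x, v2 x * v2 x <= N x, w1 x * w1 x <= N x & w2 x * w2 x <= N x].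
  have := sq (v1 x); have := sq (v2 x); have := sq (w1 x); have := sq (w2 x).
  by rewrite /N; split; lra.
have Fb (u x : R) : u * u <= N x ->
    `|u * F1 x| <= (`|c| + 2 * C) * N x /\ `|u * F2 x| <= (`|c| + 2 * C) * N x.
  move=> uN; have [v1N v2N w1N w2N] := vN x.
  have T (p q r P0 Q0 R0 : R) : `|p| <= P0 -> `|q| <= Q0 -> `|r| <= R0 ->
      `|p + (q - r)| <= P0 + (Q0 + R0) /\ `|p + (q + r)| <= P0 + (Q0 + R0).
    move=> /ler_normlP[? ?] /ler_normlP[? ?] /ler_normlP[? ?].
    by split; apply/ler_normlP; split; lra.
  have cb (m M y : R) : `|m| <= M -> y * y <= N x -> `|u * (m * y)| <= M * N x.
    move=> mM yN; rewrite mulrCA normrM.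
    apply: le_trans (ab M u y x _ uN yN); last by rewrite (le_trans _ mM).
    by rewrite ler_wpM2r.
  have -> : u * F1 x = u * (c * w1 x) + (u * (G1 x * v1 x) - u * (G2 x * v2 x)).
    by rewrite /F1; ring.
  have -> : u * F2 x = u * (c * w2 x) + (u * (G2 x * v1 x) + u * (G1 x * v2 x)).
    by rewrite /F2; ring.
  rewrite (_ : (`|c| + 2 * C) * N x = `|c| * N x + (C * N x + C * N x)); last by ring.
  split.
    by apply: (proj1 (T _ _ _ _ _ _ _ _ _)); apply: cb.
  by apply: (proj2 (T _ _ _ _ _ _ _ _ _)); apply: cb.
pose A : R := `|a1| + `|a2|.
(* In [dN / 2] the two products [v * w] count [N] each and the two products [w * z] count
   [A * (|c| + 2 * C) * N] each. *)
pose B : R := 2 * (2 + 2 * (A * (`|c| + 2 * C))).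
have A0 : 0 <= A by rewrite addr_ge0.
have B0 : 0 < B.
  by rewrite mulr_gt0 // ltr_pwDl // !mulr_ge0 // addr_ge0 // mulr_ge0.
have zb (u x : R) : u * u <= N x ->
    `|u * z1 x| <= A * (`|c| + 2 * C) * N x /\ `|u * z2 x| <= A * (`|c| + 2 * C) * N x.
  move=> uN; have [h1 h2] := Fb u x uN; rewrite ode1 ode2.
  have -> : u * - (a1 * F1 x - a2 * F2 x) = - (u * (a1 * F1 x) - u * (a2 * F2 x)) by ring.
  have -> : u * - (a2 * F1 x + a1 * F2 x) = - (u * (a1 * F2 x) + u * (a2 * F1 x)) by ring.
  rewrite !normrN.
  have H (a F : R) : `|u * F| <= (`|c| + 2 * C) * N x ->
      `|u * (a * F)| <= `|a| * ((`|c| + 2 * C) * N x).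
    by move=> h; rewrite mulrCA normrM ler_wpM2l.
  have -> : A * (`|c| + 2 * C) * N x =
      `|a1| * ((`|c| + 2 * C) * N x) + `|a2| * ((`|c| + 2 * C) * N x).
    by rewrite /A; ring.
  split.
    by rewrite (le_trans (ler_normB _ _)) // lerD // H.
  by rewrite (le_trans (ler_normD _ _)) // lerD // H.
have Nl : N x @[x --> +oo] --> (0 : R).
  have -> : 0 = 0 * 0 + 0 * 0 + 0 * 0 + 0 * 0 :> R by rewrite !mulr0 !addr0.
  by apply: cvgD; [apply: cvgD; [apply: cvgD|]|]; apply: cvgM.
pose D : R := `|a1| * 2 + `|a2| * 2 + `|aa * c / 2|.
have QD x : `|Q x| <= D * N x.
  have [v1N v2N w1N w2N] := vN x.
  have T (u v : R) : u * u <= N x -> v * v <= N x -> `|u * v| <= N x.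
    by move=> ? ?; have := ab 1 u v x ler01; rewrite !mul1r; apply.
  have H (m u M : R) : `|u| <= M -> `|m * u| <= `|m| * M.
    by move=> uM; rewrite normrM ler_wpM2l.
  have h1 : `|v1 x * w1 x + v2 x * w2 x| <= 2 * N x.
    by rewrite (le_trans (ler_normD _ _)) // mulr_natl mulr2n lerD // T.
  have h2 : `|v1 x * w2 x - v2 x * w1 x| <= 2 * N x.
    by rewrite (le_trans (ler_normB _ _)) // mulr_natl mulr2n lerD // T.
  have h3 : `|v1 x * v1 x + v2 x * v2 x| <= N x.
    rewrite ger0_norm ?addr_ge0 // /N.
    by have := sq (w1 x); have := sq (w2 x); lra.
  rewrite /Q normrN.
  have -> : D * N x = `|a1| * (2 * N x) + `|a2| * (2 * N x) + `|aa * c / 2| * N x.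
    by rewrite /D; ring.
  rewrite (le_trans (ler_normD _ _)) // lerD ?H //.
  by rewrite (le_trans (ler_normD _ _)) // lerD ?H.
pose d : R := Num.min a1 (aa * ga).
have d0 : 0 < d by rewrite lt_min a10 mulr_gt0.
have dle1 : d <= a1 by rewrite ge_min lexx.
have dle2 : d <= aa * ga by rewrite ge_min lexx orbT.
refine (@lyapunov_decay _ Q N dQ dN B (D + 1) d _ _ _ _ _ _ _ _ _ _ _) => //.
- by rewrite ltr_wpDl // /D !addr_ge0 // mulr_ge0.
- apply: nearW => x; have [v1N v2N w1N w2N] := vN x.
  have [/ler_normlP[h1 _] _] := zb (w1 x) x w1N.
  have [_ /ler_normlP[h2 _]] := zb (w2 x) x w2N.
  have /ler_normlP[h3 _] : `|v1 x * w1 x| <= N x.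
    by have := ab 1 (v1 x) (w1 x) x ler01; rewrite !mul1r; apply.
  have /ler_normlP[h4 _] : `|v2 x * w2 x| <= N x.
    by have := ab 1 (v2 x) (w2 x) x ler01; rewrite !mul1r; apply.
  rewrite /dN /B; lra.
- apply: filterS G1ga => x hG; rewrite /dQ /N.
  have vv : 0 <= v1 x * v1 x + v2 x * v2 x by rewrite addr_ge0.
  have ww : 0 <= w1 x * w1 x + w2 x * w2 x by rewrite addr_ge0.
  have h1 := ler_wpM2r vv dle2; have h2 := ler_wpM2r ww dle1.
  have h3 : aa * G1 x <= - (aa * ga) by rewrite -mulrN ler_wpM2l // ltW.
  have h4 := ler_wpM2r vv h3; lra.
- apply: nearW => x; rewrite (le_trans (ler_norm _)) // (le_trans (QD x)) //.
  by rewrite ler_wpM2r // lerDl.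
- apply/norm_cvg0P; apply: (squeeze_cvgr (f := fun=> 0) (h := fun x => D * N x)).
  + by apply: nearW => x; rewrite normr_ge0 QD.
  + exact: cvg_cst.
  + by rewrite -[0](mulr0 D); apply: cvgM => //; exact: cvg_cst.
Qed.

(** Pairing the equation with [v] turns [G v] into [G |v| ^ 2], so the hypotheses expand [G1 * s]
    and [G2 * s] to first order in [sg]. Then [sg], [p], [q] solve a system covered by
    [hyperbolic_decay], perturbed by [|v'| ^ 2] and the remainders [E1], [E2]. *)
Lemma front_decay (b d l1 l2 : R) : 0 < c -> 0 < b -> 0 < l1 * l1 + l2 * l2 ->
    let s x := v1 x * v1 x + v2 x * v2 x in
    let sg x := s x - (l1 * l1 + l2 * l2) in
    (forall e : R, 0 < e ->
      \forall x \near +oo_R, `|G1 x * s x + b * sg x| <= e * `|sg x|) ->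
    (forall e : R, 0 < e ->
      \forall x \near +oo_R, `|G2 x * s x - d * sg x| <= e * `|sg x|) ->
    v1 x @[x --> +oo] --> l1 -> v2 x @[x --> +oo] --> l2 ->
    w1 x @[x --> +oo] --> (0 : R) -> w2 x @[x --> +oo] --> (0 : R) ->
  [/\ exp_decay sg, exp_decay w1 & exp_decay w2].
Proof.
set r : R := l1 * l1 + l2 * l2 => c0 b0 r0 s sg G1s G2s v1l v2l w10 w20.
pose p (x : R) : R := v1 x * w1 x + v2 x * w2 x.
pose q (x : R) : R := v1 x * w2 x - v2 x * w1 x.
pose n (x : R) : R := `|sg x| + `|p x| + `|q x|.
pose k : R := c * a1; pose l : R := c * a2.
pose e1 : R := a1 * b + a2 * d; pose e2 : R := a2 * b - a1 * d.
pose E1 (x : R) : R := G1 x * s x + b * sg x.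
pose E2 (x : R) : R := G2 x * s x - d * sg x.
pose h1 (x : R) : R := w1 x * w1 x + w2 x * w2 x - a1 * E1 x + a2 * E2 x.
pose h2 (x : R) : R := - a2 * E1 x - a1 * E2 x.
have sq (u : R) : 0 <= u * u by rewrite -expr2 sqr_ge0.
have sg' x : has_deriv sg x (2 * p x) by rewrite /sg /s /p; derive_ring.
have p' x : has_deriv p x (- k * p x + l * q x + e1 * sg x + h1 x).
  rewrite /p; apply: has_deriv_eq; first by derive_rules.
  cbv beta; rewrite ode1 ode2 /F1 /F2 /h1 /E1 /E2 /e1 /k /l /p /q /sg /s.
  ring.
have q' x : has_deriv q x (- k * q x - l * p x + e2 * sg x + h2 x).
  rewrite /q; apply: has_deriv_eq; first by derive_rules.
  cbv beta; rewrite ode1 ode2 /F1 /F2 /h2 /E1 /E2 /e2 /k /l /p /q /sg /s.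
  ring.
have k0 : 0 < k by rewrite mulr_gt0.
have B0 : 0 < k * e1 + l * e2.
  (* The terms in [d] cancel, so hyperbolicity comes down to the signs of [c] and [b]. *)
  rewrite (_ : k * e1 + l * e2 = c * b * (a1 * a1 + a2 * a2)); last first.
    by rewrite /k /l /e1 /e2; ring.
  by rewrite !mulr_gt0 // ltr_pwDl // mulr_gt0.
have sl : s x @[x --> +oo] --> r by apply: cvgD; apply: cvgM.
have sgl : sg x @[x --> +oo] --> (0 : R).
  by rewrite -[0](subrr r); apply: cvgB => //; exact: cvg_cst.
have pl : p x @[x --> +oo] --> (0 : R).
  by rewrite (_ : 0 = l1 * 0 + l2 * 0 :> R); [apply: cvgD; apply: cvgM | rewrite !mulr0 addr0].
have ql : q x @[x --> +oo] --> (0 : R).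
  by rewrite (_ : 0 = l1 * 0 - l2 * 0 :> R); [apply: cvgB; apply: cvgM | rewrite !mulr0 subr0].
have r20 : 0 < r / 2 by rewrite divr_gt0.
have sge : \forall x \near +oo_R, r / 2 <= s x.
  have P := cvgr_dist_le _ _ sl _ r20; near=> x.
  have /ler_normlP[_] : `|r - s x| <= r / 2 by near: x; exact: P.
  lra.
(* This is [|v| ^ 2 |v'| ^ 2 = p ^ 2 + q ^ 2]. As [|v|] stays away from [0], it bounds [v'] by the
   invariants. *)
have wwE x : s x * (w1 x * w1 x + w2 x * w2 x) = p x * p x + q x * q x.
  by rewrite /s /p /q; ring.
have ww x : r / 2 <= s x -> r / 2 * (w1 x * w1 x + w2 x * w2 x) <= p x * p x + q x * q x.
  by move=> sx; rewrite -wwE ler_wpM2r // addr_ge0.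
have E1o e : 0 < e -> \forall x \near +oo_R, `|E1 x| <= e * n x.
  move=> e0; have := G1s e e0; apply: filterS => x /le_trans; apply.
  by rewrite ler_wpM2l ?(ltW e0) // /n -addrA lerDl addr_ge0.
have E2o e : 0 < e -> \forall x \near +oo_R, `|E2 x| <= e * n x.
  move=> e0; have := G2s e e0; apply: filterS => x /le_trans; apply.
  by rewrite ler_wpM2l ?(ltW e0) // /n -addrA lerDl addr_ge0.
(* [|v'| ^ 2] is of second order in [p] and [q], which tend to [0]. *)
have wwo e : 0 < e -> \forall x \near +oo_R, w1 x * w1 x + w2 x * w2 x <= e * n x.
  move=> e0; have e0' : 0 < e * (r / 2) by rewrite mulr_gt0.
  have P := cvgr0_norm_le _ pl _ e0'; have Q := cvgr0_norm_le _ ql _ e0'.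
  near=> x; rewrite -(ler_pM2l r20).
  have sx : r / 2 <= s x by near: x.
  apply: (le_trans (ww x sx)).
  have px : `|p x| <= e * (r / 2) by near: x; exact: P.
  have qx : `|q x| <= e * (r / 2) by near: x; exact: Q.
  have N2 (t : R) : t * t = `|t| * `|t| by rewrite -normrM ger0_norm.
  rewrite (N2 (p x)) (N2 (q x)).
  have H1 := ler_wpM2r (normr_ge0 (p x)) px; have H2 := ler_wpM2r (normr_ge0 (q x)) qx.
  have H3 : 0 <= e * (r / 2) * `|sg x| by rewrite mulr_ge0 // ltW.
  by rewrite /n; lra.
have comb (m1 m2 : R) (y : R -> R) (al : R) : 0 <= al ->
   (forall x, `|y x| <= al * (w1 x * w1 x + w2 x * w2 x) + `|m1| * `|E1 x| + `|m2| * `|E2 x|) ->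
   forall e : R, 0 < e -> \forall x \near +oo_R, `|y x| <= e * n x.
  move=> al0 yb e e0.
  pose e' : R := e / (al + `|m1| + `|m2| + 1).
  have M0 : 0 < al + `|m1| + `|m2| + 1 by rewrite ltr_wpDl // !addr_ge0.
  have e0' : 0 < e' by rewrite divr_gt0.
  have P := E1o e' e0'; have Q := E2o e' e0'; have S := wwo e' e0'.
  near=> x; apply: (le_trans (yb x)).
  have H1 : al * (w1 x * w1 x + w2 x * w2 x) <= al * (e' * n x).
    by rewrite ler_wpM2l //; near: x.
  have H2 : `|m1| * `|E1 x| <= `|m1| * (e' * n x) by rewrite ler_wpM2l //; near: x.
  have H3 : `|m2| * `|E2 x| <= `|m2| * (e' * n x) by rewrite ler_wpM2l //; near: x.
  have -> : e * n x = (al + `|m1| + `|m2| + 1) * (e' * n x).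
    by rewrite /e'; field; rewrite gt_eqF.
  have H4 : 0 <= e' * n x by rewrite mulr_ge0 ?(ltW e0') // /n !addr_ge0.
  lra.
have NN := hyperbolic_decay k0 B0 sg' p' q'
  (comb a1 a2 h1 1 ler01 _) (comb a2 a1 h2 0 (lexx 0) _) sgl pl ql.
have {}NN : exp_decay (fun x => sg x * sg x + p x * p x + q x * q x).
  apply: NN => x.
  - rewrite /h1 mul1r (le_trans (ler_normD _ _)) // normrM lerD //.
    rewrite (le_trans (ler_normB _ _)) // normrM lerD //.
    by rewrite ger0_norm // addr_ge0.
  - by rewrite /h2 mul0r add0r (le_trans (ler_normB _ _)) // mulNr normrN !normrM.
have wN : exp_decay (fun x => 2 / r * (sg x * sg x + p x * p x + q x * q x)).
  exact: exp_decay_cstM.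
have wd (w : R -> R) : (forall x, w x * w x <= w1 x * w1 x + w2 x * w2 x) -> exp_decay w.
  move=> ww12; apply: (exp_decay_sqrt wN); near=> x.
  apply: (le_trans (ww12 x)); rewrite -(ler_pM2l r20).
  rewrite (_ : r / 2 * (2 / r * _) = sg x * sg x + p x * p x + q x * q x); last first.
    by field; rewrite gt_eqF.
  have sx : r / 2 <= s x by near: x.
  by rewrite (le_trans (ww x sx)) // -addrA lerDr.
split.
- by apply: (exp_decay_sqrt NN); near=> x; rewrite -addrA lerDl addr_ge0.
- by apply: wd => x; rewrite lerDl.
- by apply: wd => x; rewrite lerDr.
Unshelve. all: by end_near. Qed.

(** The equation expresses [v''] through [v'] and [G v], and its derivative expresses [v'''] through
    products of a bounded and a decaying function. Decay is asked of [G v] and not of [v], which has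
    a nonzero limit at the right end. *)
Lemma higher_decay (C : R) (dG1 dG2 t1 t2 : R -> R) :
    (forall x, `|v1 x| <= C) -> (forall x, `|v2 x| <= C) ->
    (forall x, `|G1 x| <= C) -> (forall x, `|G2 x| <= C) ->
    (forall x, has_deriv G1 x (dG1 x)) -> (forall x, has_deriv G2 x (dG2 x)) ->
    (forall x, has_deriv z1 x (t1 x)) -> (forall x, has_deriv z2 x (t2 x)) ->
    exp_decay w1 -> exp_decay w2 -> exp_decay dG1 -> exp_decay dG2 ->
    exp_decay (fun x => G1 x * v1 x - G2 x * v2 x) ->
    exp_decay (fun x => G2 x * v1 x + G1 x * v2 x) ->
  [/\ exp_decay z1, exp_decay z2, exp_decay t1 & exp_decay t2].
Proof.
move=> v1C v2C G1C G2C G1' G2' z1' z2' w1d w2d dG1d dG2d H1d H2d.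
have z1E : z1 = fun x => - (a1 * F1 x - a2 * F2 x) by apply/funext.
have z2E : z2 = fun x => - (a2 * F1 x + a1 * F2 x) by apply/funext.
have F1d : exp_decay F1 by apply: exp_decayD => //; exact: exp_decay_cstM.
have F2d : exp_decay F2 by apply: exp_decayD => //; exact: exp_decay_cstM.
have z1d : exp_decay z1.
  rewrite z1E; apply: exp_decayN; apply: exp_decayD; last apply: exp_decayN;
    exact: exp_decay_cstM.
have z2d : exp_decay z2.
  by rewrite z2E; apply: exp_decayN; apply: exp_decayD; exact: exp_decay_cstM.
pose dF1 x := c * z1 x + (v1 x * dG1 x + G1 x * w1 x - (v2 x * dG2 x + G2 x * w2 x)).
pose dF2 x := c * z2 x + (v1 x * dG2 x + G2 x * w1 x + (v2 x * dG1 x + G1 x * w2 x)).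
have F1' x : has_deriv F1 x (dF1 x) by rewrite /F1 /dF1; derive_ring.
have F2' x : has_deriv F2 x (dF2 x) by rewrite /F2 /dF2; derive_ring.
have t1E : t1 = fun x => - (a1 * dF1 x - a2 * dF2 x).
  apply/funext => x; rewrite -(has_deriv_val (z1' x)) {1}z1E; apply: has_deriv_val.
  by derive_ring.
have t2E : t2 = fun x => - (a2 * dF1 x + a1 * dF2 x).
  apply/funext => x; rewrite -(has_deriv_val (z2' x)) {1}z2E; apply: has_deriv_val.
  by derive_ring.
have dF1d : exp_decay dF1.
  apply: exp_decayD; first exact: exp_decay_cstM.
  apply: exp_decayD; last apply: exp_decayN; apply: exp_decayD.
  - exact: exp_decayM v1C _.
  - exact: exp_decayM G1C _.
  - exact: exp_decayM v2C _.
  - exact: exp_decayM G2C _.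
have dF2d : exp_decay dF2.
  apply: exp_decayD; first exact: exp_decay_cstM.
  apply: exp_decayD; apply: exp_decayD.
  - exact: exp_decayM v1C _.
  - exact: exp_decayM G2C _.
  - exact: exp_decayM v2C _.
  - exact: exp_decayM G1C _.
split=> //.
  rewrite t1E; apply: exp_decayN; apply: exp_decayD; last apply: exp_decayN;
    exact: exp_decay_cstM.
by rewrite t2E; apply: exp_decayN; apply: exp_decayD; exact: exp_decay_cstM.
Qed.

End Ends.

(** * Bounded functions with bounded derivatives *)

Section Regularity.
Variable R : realType.

Lemma bounded_funP (V : normedModType R) (f : R -> V) :
  bounded_fun f <-> exists M, forall x, `|f x| <= M.
Proof.
have GF : ProperFilter (globally (@setT R)) by exact: (@globally_properfilter _ _ (0 : R)).
have [H1 H2] := @ex_bound _ _ _ f _ GF; split=> [/H1[M fM]|[M fM]].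
  by exists M => x; exact: fM.
by apply: H2; exists M => x _; exact: fM.
Qed.

(** Peeling off the innermost derivative allows induction on the order, with the function
    generalized. *)
Lemma CkS (V : normedModType R) k (f : R -> V) :
  Ck k.+1 f <-> (forall x, derivable f x 1) /\ Ck k (derive1 f).
Proof.
rewrite /Ck derive1Sn; split=> [[fk fc]|[f0 [fk fc]]].
  split; first exact: (fk 0%N).
  by split=> // j jk; rewrite -derive1Sn; exact: fk.
split=> // -[_|j jk]; first exact: f0.
by rewrite derive1Sn; exact: fk.
Qed.

Lemma CkbS (V : normedModType R) k (f : R -> V) :
  Ckb k.+1 f <->
  [/\ bounded_fun f, forall x, derivable f x 1 & Ckb k (derive1 f)].
Proof.
split=> [[/CkS[f0 fk] fb]|[b0 f0 [fk fb]]].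
  split=> //; first exact: (fb 0%N).
  by split=> // j jk; rewrite -derive1Sn; exact: fb.
split; first by apply/CkS.
move=> [_|j jk]; first exact: b0.
by rewrite derive1Sn; exact: fb.
Qed.

Lemma Ckb0 (V : normedModType R) (f : R -> V) :
  Ckb 0 f <-> continuous f /\ bounded_fun f.
Proof.
split=> [[[_ fc] fb]|[fc fb]]; first by split=> //; exact: (fb 0%N).
by split=> [|[|]//]; split.
Qed.

Lemma derivable_continuous (V : normedModType R) (f : R -> V) :
  (forall x, derivable f x 1) -> continuous f.
Proof.
by move=> df x; apply/differentiable_continuous/derivable1_diffP; exact: df.
Qed.

Lemma CkW (V : normedModType R) k (f : R -> V) : Ck k.+1 f -> Ck k f.
Proof.
elim: k f => [|k IHk] f /CkS[f0 fk].
  by split=> //; exact: derivable_continuous.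
by apply/CkS; split=> //; exact: IHk.
Qed.

Lemma CkbW (V : normedModType R) k (f : R -> V) : Ckb k.+1 f -> Ckb k f.
Proof.
elim: k f => [|k IHk] f /CkbS[b0 f0 fk].
  by apply/Ckb0; split=> //; exact: derivable_continuous.
by apply/CkbS; split=> //; exact: IHk.
Qed.

Lemma Ck_le (V : normedModType R) j k (f : R -> V) :
  (j <= k)%N -> Ck k f -> Ck j f.
Proof.
move=> /subnK <-; elim: (k - j)%N => [//|i IHi] fk.
by apply: IHi; exact: CkW.
Qed.

Lemma Ckb_le (V : normedModType R) j k (f : R -> V) :
  (j <= k)%N -> Ckb k f -> Ckb j f.
Proof.
move=> /subnK <-; elim: (k - j)%N => [//|i IHi] fk.
by apply: IHi; exact: CkbW.
Qed.

Lemma Ckb_bounded (V : normedModType R) k (f : R -> V) :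
  Ckb k f -> exists M, forall x, `|f x| <= M.
Proof. by case=> _ /(_ 0%N isT) /bounded_funP. Qed.

Lemma Ckb_has_deriv k (f : R -> R) : Ckb k.+1 f ->
  forall x, has_deriv f x (derive1 f x).
Proof. by move=> /CkbS[_ f0 _] x; exact: derivable_has_deriv. Qed.

(** One order is gained from a formula for the derivative; the closure properties and the bootstrap
    both advance in this way. *)
Lemma CkbSI k (f df : R -> R) : (exists M, forall x, `|f x| <= M) ->
  (forall x, has_deriv f x (df x)) -> Ckb k df -> Ckb k.+1 f.
Proof.
move=> fb fdf dfk; apply/CkbS; split; first exact/bounded_funP.
  by move=> x; exact: has_deriv_derivable.
by rewrite (_ : derive1 f = df) //; apply/funext => x; exact: has_deriv_val.
Qed.

Lemma Ckb_cst k (a : R) : Ckb k (fun=> a : R).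
Proof.
have fb (b : R) : exists M : R, R -> `|b| <= M by exists `|b|.
elim: k a => [|k IHk] a.
  by apply/Ckb0; split; [exact: cst_continuous | exact/bounded_funP].
by apply: (CkbSI (df := fun=> 0)) => // x; exact: has_deriv_cst.
Qed.

Lemma CkbD k (f g : R -> R) : Ckb k f -> Ckb k g -> Ckb k (fun x => f x + g x).
Proof.
have fb (f' g' : R -> R) j : Ckb j f' -> Ckb j g' ->
    exists M, forall x, `|f' x + g' x| <= M.
  move=> /Ckb_bounded[A fA] /Ckb_bounded[B gB]; exists (A + B) => x.
  by rewrite (le_trans (ler_normD _ _)) // lerD.
elim: k f g => [|k IHk] f g fk gk; have fg := fb _ _ _ fk gk.
  move: fk gk => /Ckb0[fc _] /Ckb0[gc _]; apply/Ckb0; split; last exact/bounded_funP.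
  by move=> x; exact: (continuousD (fc x) (gc x)).
apply: (CkbSI (df := fun x => derive1 f x + derive1 g x)) => //.
  by move=> x; apply: has_derivD; [exact: (Ckb_has_deriv fk) | exact: (Ckb_has_deriv gk)].
by move: fk gk => /CkbS[_ _ ?] /CkbS[_ _ ?]; exact: IHk.
Qed.

Lemma CkbM k (f g : R -> R) : Ckb k f -> Ckb k g -> Ckb k (fun x => f x * g x).
Proof.
have fb (f' g' : R -> R) j : Ckb j f' -> Ckb j g' ->
    exists M, forall x, `|f' x * g' x| <= M.
  move=> /Ckb_bounded[A fA] /Ckb_bounded[B gB]; exists (A * B) => x.
  by rewrite normrM ler_pM.
elim: k f g => [|k IHk] f g fk gk; have fg := fb _ _ _ fk gk.
  move: fk gk => /Ckb0[fc _] /Ckb0[gc _]; apply/Ckb0; split; last exact/bounded_funP.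
  by move=> x; exact: (continuousM (fc x) (gc x)).
apply: (CkbSI (df := fun x => derive1 f x * g x + f x * derive1 g x)) => //.
  by move=> x; apply: has_derivM; [exact: (Ckb_has_deriv fk) | exact: (Ckb_has_deriv gk)].
have fk' := CkbW fk; have gk' := CkbW gk.
by move: fk gk => /CkbS[_ _ ?] /CkbS[_ _ ?]; apply: CkbD; exact: IHk.
Qed.

Lemma CkbN k (f : R -> R) : Ckb k f -> Ckb k (fun x => - f x).
Proof.
move=> fk; rewrite (_ : (fun x => - f x) = (fun x => -1 * f x)).
  by apply: CkbM => //; exact: Ckb_cst.
by apply/funext => x; rewrite mulN1r.
Qed.

Lemma continuous_bounded_comp (g s : R -> R) : continuous g ->
  (exists M, forall x, `|s x| <= M) -> exists M, forall x, `|g (s x)| <= M.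
Proof.
move=> gc [M sM].
have : compact (g @` `[- M, M]).
  by apply: continuous_compact; [exact: continuous_subspaceT | exact: segment_compact].
move=> /compact_bounded[A [_ gA]]; exists (A + 1) => x.
apply: (gA (A + 1)); [by rewrite ltrDl | exists (s x) => //=].
by rewrite in_itv /= -ler_norml.
Qed.

(** No bound on [g] is assumed: [s] takes its values in a compact segment, on which [g] and its
    derivatives are bounded. *)
Lemma Ckb_comp k (g s : R -> R) : Ck k g -> Ckb k s -> Ckb k (fun x => g (s x)).
Proof.
elim: k g s => [|k IHk] g s gk sk; have sb := Ckb_bounded sk.
  move: gk sk => [_ gc] /Ckb0[sc _]; apply/Ckb0; split.
    by move=> x; apply: continuous_comp; [exact: sc | exact: gc].
  exact/bounded_funP/continuous_bounded_comp.
have sk' := CkbW sk.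
move: gk => /CkS[g0 gk].
apply: (CkbSI (df := fun x => derive1 g (s x) * derive1 s x)).
- exact: (continuous_bounded_comp (derivable_continuous g0)).
- by move=> x; apply: has_deriv_comp; [exact: derivable_has_deriv | exact: (Ckb_has_deriv sk)].
- by apply: CkbM; [exact: IHk | case/CkbS: sk].
Qed.

(** * Regularity of matrix-valued functions, entry by entry *)

Section Matrix.
Variables m n : nat.
Implicit Types f : R -> 'M[R]_(m.+1, n.+1).

Lemma mx_norm_le (A : 'M[R]_(m.+1, n.+1)) M :
  `|A| <= M <-> forall i j, `|A i j| <= M.
Proof.
rewrite [`|A|]/Num.Def.normr /= mx_normrE; split => [AM i j|AM].
  by apply: le_trans AM; exact: (le_bigmax _ (fun ij => `|A ij.1 ij.2|) (i, j)).
apply: bigmax_le => [|[i j] _] //.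
(* The maximum starts from [0], and [0 <= M] follows from one entry, which exists as both dimensions
   are positive. *)
exact: le_trans (AM ord0 ord0).
Qed.

Lemma mx_continuous f :
  continuous f <-> forall i j, continuous (fun x => f x i j).
Proof.
split=> [fc i j x|fc x].
  exact: (@continuous_comp _ _ _ f (fun M => M i j) x (fc x) (@coord_continuous _ _ _ i j (f x))).
apply/cvgrPdist_le => e e0; near=> y; apply/mx_norm_le.
move=> i j; rewrite !mxE; move: i j; near: y.
apply: filter_forall => i; apply: filter_forall => j.
exact: (cvgr_dist_le _ _ (fc i j x) _ e0).
Unshelve. all: by end_near. Qed.

Lemma mx_bounded f :
  bounded_fun f <-> forall i j, bounded_fun (fun x => f x i j).
Proof.
split=> [/bounded_funP[M fM] i j|fb].
  by apply/bounded_funP; exists M => x; move: (fM x) => /mx_norm_le.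
have fb' i j : exists M, forall x, `|f x i j| <= M by apply/bounded_funP; exact: fb.
have [F FP] := choice (fun ij : 'I_m.+1 * 'I_n.+1 => fb' ij.1 ij.2).
apply/bounded_funP; exists (\big[Num.max/0]_ij F ij) => x; apply/mx_norm_le => i j.
by rewrite (le_trans (FP (i, j) x)) // le_bigmax.
Qed.

Lemma derive1_mx f x i j : derivable f x 1 ->
  derive1 f x i j = derive1 (fun y => f y i j) x.
Proof. by move=> fx; rewrite !derive1E derive_mx // mxE. Qed.

Lemma Ck_mx k f : Ck k f -> forall i j, Ck k (fun x => f x i j).
Proof.
elim: k f => [|k IHk] f.
  by move=> [_ /mx_continuous fc] i j; split=> //; exact: fc.
move=> /CkS[f0 fk] i j; apply/CkS; split.
  by move=> x; move: (f0 x) => /derivable_mxP.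
rewrite (_ : derive1 _ = fun x => derive1 f x i j); first exact: IHk.
by apply/funext => x; rewrite derive1_mx.
Qed.

Lemma Ckb_mx k f : Ckb k f <-> forall i j, Ckb k (fun x => f x i j).
Proof.
elim: k f => [|k IHk] f.
  rewrite Ckb0 mx_continuous mx_bounded; split=> [[fc fb] i j|fk].
    by apply/Ckb0.
  by split=> i j; case/Ckb0: (fk i j).
have E : (forall x, derivable f x 1) -> forall i j,
    derive1 (fun x => f x i j) = fun x => derive1 f x i j.
  by move=> f0 i j; apply/funext => x; rewrite derive1_mx.
split=> [/CkbS[/mx_bounded fb f0 /IHk fk] i j|fk].
  apply/CkbS; split; [exact: fb | | by rewrite E].
  by move=> x; move: (f0 x) => /derivable_mxP.
have f0 x : derivable f x 1.
  by apply/derivable_mxP => i j; case/CkbS: (fk i j).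
apply/CkbS; split=> //.
  by apply/mx_bounded => i j; case/CkbS: (fk i j).
by apply/IHk => i j; rewrite -E //; case/CkbS: (fk i j).
Qed.

End Matrix.
End Regularity.

(** * Real and imaginary parts of a front *)

(** Caratheodory's slope function is continuous at [y], which avoids dividing by [s x - y], a
    quantity that may vanish. *)
Lemma has_deriv_expansion (R : realType) (f s : R -> R) (y m : R) :
    has_deriv f y m -> s x @[x --> +oo] --> y ->
  forall e, 0 < e ->
    \forall x \near +oo_R, `|f (s x) - f y - m * (s x - y)| <= e * `|s x - y|.
Proof.
move=> /is_derive1_caratheodory[h [fE hc hy]] sy e e0.
have hs : h (s x) @[x --> +oo] --> h y by exact: (continuous_cvg _ hc sy).
have P := cvgr_dist_le _ _ hs _ e0.
near=> x; rewrite fE -hy -mulrBl normrM distrC ler_wpM2r //.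
by near: x; exact: P.
Unshelve. all: by end_near. Qed.

Section ScalarFront.
Variable R : realType.
Variables (a1 a2 c om r : R) (g1 g2 v1 v2 : R -> R).
Hypothesis a10 : 0 < a1.
Hypothesis c0 : 0 < c.
Hypothesis g1C : Ck 3 g1.
Hypothesis g2C : Ck 3 g2.
Hypothesis g10 : g1 0 < 0.
Hypothesis v1C : Ckb 2 v1.
Hypothesis v2C : Ckb 2 v2.
Let s x := v1 x * v1 x + v2 x * v2 x.
Let w1 := derive1 v1.
Let w2 := derive1 v2.
Let z1 := derive1 w1.
Let z2 := derive1 w2.
Let t1 := derive1 z1.
Let t2 := derive1 z2.
Let G1 x := g1 (s x).
(** The rotation term is multiplication by [i om], so it is absorbed into the imaginary part of
    [g]. *)
Let G2 x := g2 (s x) + om.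
Let F1 x := c * w1 x + (G1 x * v1 x - G2 x * v2 x).
Let F2 x := c * w2 x + (G2 x * v1 x + G1 x * v2 x).
Hypothesis ode1 : forall x, z1 x = - (a1 * F1 x - a2 * F2 x).
Hypothesis ode2 : forall x, z2 x = - (a2 * F1 x + a1 * F2 x).

Let v1' x : has_deriv v1 x (w1 x). Proof. exact: (Ckb_has_deriv v1C). Qed.
Let v2' x : has_deriv v2 x (w2 x). Proof. exact: (Ckb_has_deriv v2C). Qed.
Let w1C : Ckb 1 w1. Proof. by case/CkbS: v1C. Qed.
Let w2C : Ckb 1 w2. Proof. by case/CkbS: v2C. Qed.
Let w1' x : has_deriv w1 x (z1 x). Proof. exact: (Ckb_has_deriv w1C). Qed.
Let w2' x : has_deriv w2 x (z2 x). Proof. exact: (Ckb_has_deriv w2C). Qed.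

(** If [v] and [v'] have order [k <= 3], so does [v''] by the equation, [g] being of class [C^3];
    hence [v] and [v'] have order [k + 1]. This stops at order 4 for [v'], that is order 5 for
    [v]. *)
Lemma Ckb_profile : Ckb 5 v1 /\ Ckb 5 v2.
Proof.
pose P k := [/\ Ckb k v1, Ckb k v2, Ckb k w1 & Ckb k w2].
have step k : (k <= 3)%N -> P k -> P k.+1.
  move=> k3 [v1k v2k w1k w2k].
  have sk : Ckb k s by apply: CkbD; exact: CkbM.
  have G1k : Ckb k G1 by apply: Ckb_comp => //; exact: Ck_le k3 g1C.
  have G2k : Ckb k G2.
    apply: CkbD; last exact: Ckb_cst.
    by apply: Ckb_comp => //; exact: Ck_le k3 g2C.
  have F1k : Ckb k F1.
    apply: CkbD; first by apply: CkbM => //; exact: Ckb_cst.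
    by apply: CkbD; last apply: CkbN; exact: CkbM.
  have F2k : Ckb k F2.
    apply: CkbD; first by apply: CkbM => //; exact: Ckb_cst.
    by apply: CkbD; exact: CkbM.
  have z1k : Ckb k z1.
    rewrite (_ : z1 = fun x => - (a1 * F1 x - a2 * F2 x)); last exact/funext.
    apply: CkbN; apply: CkbD; last apply: CkbN;
      by apply: CkbM => //; exact: Ckb_cst.
  have z2k : Ckb k z2.
    rewrite (_ : z2 = fun x => - (a2 * F1 x + a1 * F2 x)); last exact/funext.
    by apply: CkbN; apply: CkbD; apply: CkbM => //; exact: Ckb_cst.
  split; [exact: CkbSI (Ckb_bounded v1C) v1' w1k | exact: CkbSI (Ckb_bounded v2C) v2' w2k
    | exact: CkbSI (Ckb_bounded w1C) w1' z1k | exact: CkbSI (Ckb_bounded w2C) w2' z2k].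
have P1 : P 1%N.
  by split; [exact: CkbW v1C | exact: CkbW v2C | exact: w1C | exact: w2C].
have [_ _ w14 w24] := step 3%N isT (step 2%N isT (step 1%N isT P1)).
by split; [exact: CkbSI (Ckb_bounded v1C) v1' w14 | exact: CkbSI (Ckb_bounded v2C) v2' w24].
Qed.

Let z1' x : has_deriv z1 x (t1 x).
Proof.
by have [/CkbS[_ _ /CkbS[_ _ z1C]] _] := Ckb_profile; exact: (Ckb_has_deriv z1C).
Qed.

Let z2' x : has_deriv z2 x (t2 x).
Proof.
by have [_ /CkbS[_ _ /CkbS[_ _ z2C]]] := Ckb_profile; exact: (Ckb_has_deriv z2C).
Qed.

Let p x := v1 x * w1 x + v2 x * w2 x.
Let dG1 x := derive1 g1 (s x) * (2 * p x).
Let dG2 x := derive1 g2 (s x) * (2 * p x).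

Let s' x : has_deriv s x (2 * p x). Proof. by rewrite /s /p; derive_ring. Qed.

Let g1' y : has_deriv g1 y (derive1 g1 y).
Proof. by apply: derivable_has_deriv; case/CkS: g1C. Qed.

Let g2' y : has_deriv g2 y (derive1 g2 y).
Proof. by apply: derivable_has_deriv; case/CkS: g2C. Qed.

Let G1' x : has_deriv G1 x (dG1 x).
Proof.
exact: (has_deriv_comp (g1' _) (s' x)).
Qed.

Let G2' x : has_deriv G2 x (dG2 x).
Proof.
rewrite -[dG2 x]addr0; apply: has_derivD; last exact: has_deriv_cst.
exact: (has_deriv_comp (g2' _) (s' x)).
Qed.

(** One constant for all the bounded functions that occur at either end. *)
Let bound : exists C : R, forall x, 
  [/\ `|v1 x| <= C, `|v2 x| <= C, `|z1 x| <= C & `|z2 x| <= C] /\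
  [/\ `|G1 x| <= C, `|G2 x| <= C, `|derive1 g1 (s x)| <= C & `|derive1 g2 (s x)| <= C].
Proof.
have v10 : Ckb 0 v1 by exact: CkbW (CkbW v1C).
have v20 : Ckb 0 v2 by exact: CkbW (CkbW v2C).
have sC : Ckb 0 s by apply: CkbD; exact: CkbM.
have /Ckb_bounded[A1 h1] := v10; have /Ckb_bounded[A2 h2] := v20.
have /Ckb_bounded[A3 h3] : Ckb 0 z1 by case/CkbS: w1C.
have /Ckb_bounded[A4 h4] : Ckb 0 z2 by case/CkbS: w2C.
have /Ckb_bounded[A5 h5] : Ckb 0 G1 by apply: Ckb_comp sC; exact: Ck_le g1C.
have /Ckb_bounded[A6 h6] : Ckb 0 G2.
  by apply: CkbD; [apply: Ckb_comp sC; exact: Ck_le g2C | exact: Ckb_cst].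
have /Ckb_bounded[A7 h7] : Ckb 0 (fun x => derive1 g1 (s x)).
  by apply: Ckb_comp sC; case/CkS: g1C => _ dg; exact: Ck_le dg.
have /Ckb_bounded[A8 h8] : Ckb 0 (fun x => derive1 g2 (s x)).
  by apply: Ckb_comp sC; case/CkS: g2C => _ dg; exact: Ck_le dg.
exists (Num.max A1 (Num.max A2 (Num.max A3 (Num.max A4
  (Num.max A5 (Num.max A6 (Num.max A7 A8))))))) => x.
have L (t A B : R) : t <= A -> t <= Num.max A B by move=> tA; rewrite le_max tA.
have Rm (t A B : R) : t <= B -> t <= Num.max A B by move=> tB; rewrite le_max tB orbT.
split; split.
- exact: L _ _ _ (h1 x).
- exact: Rm _ _ _ (L _ _ _ (h2 x)).
- exact: Rm _ _ _ (Rm _ _ _ (L _ _ _ (h3 x))).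
- exact: Rm _ _ _ (Rm _ _ _ (Rm _ _ _ (L _ _ _ (h4 x)))).
- exact: Rm _ _ _ (Rm _ _ _ (Rm _ _ _ (Rm _ _ _ (L _ _ _ (h5 x))))).
- exact: Rm _ _ _ (Rm _ _ _ (Rm _ _ _ (Rm _ _ _ (Rm _ _ _ (L _ _ _ (h6 x)))))).
- exact: Rm _ _ _ (Rm _ _ _ (Rm _ _ _ (Rm _ _ _ (Rm _ _ _ (Rm _ _ _ (L _ _ _ (h7 x))))))).
- exact: Rm _ _ _ (Rm _ _ _ (Rm _ _ _ (Rm _ _ _ (Rm _ _ _ (Rm _ _ _ (Rm _ _ _ (h8 x))))))).
Qed.

Lemma profile_decay_pinfty : r != 0 -> derive1 g1 (r * r) < 0 ->
    v1 x @[x --> +oo] --> r -> v2 x @[x --> +oo] --> (0 : R) ->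
  [/\ exp_decay (fun x => v1 x - r), exp_decay v2, exp_decay w1 & exp_decay w2] /\
  [/\ exp_decay z1, exp_decay z2, exp_decay t1 & exp_decay t2].
Proof.
move=> r0 dg1r v1l v2l; have [C HC] := bound.
have w10 : w1 x @[x --> +oo] --> (0 : R).
  by apply: (deriv_cvg0 v1' w1' _ v1l) => x; case: (HC x) => -[_ _ + _] _; exact.
have w20 : w2 x @[x --> +oo] --> (0 : R).
  by apply: (deriv_cvg0 v2' w2' _ v2l) => x; case: (HC x) => -[_ _ _ +] _; exact.
have rr0 : 0 < r * r by rewrite -expr2 exprn_even_gt0.
have sl : s x @[x --> +oo] --> r * r.
  by rewrite -[r * r]addr0 -[X in _ + X](mulr0 (0 : R)); apply: cvgD; apply: cvgM.
have G1l : G1 x @[x --> +oo] --> g1 (r * r).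
  exact: (continuous_cvg _ (has_deriv_continuous (g1' _)) sl).
have G2l : G2 x @[x --> +oo] --> g2 (r * r) + om.
  apply: cvgD; last exact: cvg_cst.
  exact: (continuous_cvg _ (has_deriv_continuous (g2' _)) sl).
(* By the equation [v''] converges, and to [0] because [v'] converges; so
   [a * (g (r ^ 2) + i om) * r = 0]. *)
have [G10 G20] : g1 (r * r) = 0 /\ g2 (r * r) + om = 0.
  have F1l : F1 x @[x --> +oo] --> c * 0 + (g1 (r * r) * r - (g2 (r * r) + om) * 0).
    apply: cvgD; first by apply: cvgM => //; exact: cvg_cst.
    by apply: cvgB; apply: cvgM.
  have F2l : F2 x @[x --> +oo] --> c * 0 + ((g2 (r * r) + om) * r + g1 (r * r) * 0).
    apply: cvgD; first by apply: cvgM => //; exact: cvg_cst.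
    by apply: cvgD; apply: cvgM.
  have Z1 := lim_deriv_eq0 (m := - (a1 * _ - a2 * _)) w1' w10.
  have Z2 := lim_deriv_eq0 (m := - (a2 * _ + a1 * _)) w2' w20.
  have {}Z1 : - (a1 * (c * 0 + (g1 (r * r) * r - (g2 (r * r) + om) * 0))
      - a2 * (c * 0 + ((g2 (r * r) + om) * r + g1 (r * r) * 0))) = 0.
    apply: Z1; rewrite (_ : z1 = fun x => - (a1 * F1 x - a2 * F2 x)); last exact/funext.
    by apply: cvgN; apply: cvgB; apply: cvgM => //; exact: cvg_cst.
  have {}Z2 : - (a2 * (c * 0 + (g1 (r * r) * r - (g2 (r * r) + om) * 0))
      + a1 * (c * 0 + ((g2 (r * r) + om) * r + g1 (r * r) * 0))) = 0.
    apply: Z2; rewrite (_ : z2 = fun x => - (a2 * F1 x + a1 * F2 x)); last exact/funext.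
    by apply: cvgN; apply: cvgD; apply: cvgM => //; exact: cvg_cst.
  (* Multiplication by the conjugate of [a] isolates each part, up to the nonzero factor
     [|a| ^ 2 * r]. *)
  have aa : (a1 * a1 + a2 * a2) * r != 0.
    by rewrite mulf_neq0 // gt_eqF // ltr_pwDl ?mulr_gt0 // -expr2 sqr_ge0.
  split; apply: (mulfI aa); rewrite mulr0.
  - transitivity (a1 * (a1 * (g1 (r * r) * r) - a2 * ((g2 (r * r) + om) * r))
      + a2 * (a2 * (g1 (r * r) * r) + a1 * ((g2 (r * r) + om) * r))); first by ring.
    have -> : a1 * (g1 (r * r) * r) - a2 * ((g2 (r * r) + om) * r) = 0 by lra.
    have -> : a2 * (g1 (r * r) * r) + a1 * ((g2 (r * r) + om) * r) = 0 by lra.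
    by rewrite !mulr0 addr0.
  - transitivity (a1 * (a2 * (g1 (r * r) * r) + a1 * ((g2 (r * r) + om) * r))
      - a2 * (a1 * (g1 (r * r) * r) - a2 * ((g2 (r * r) + om) * r))); first by ring.
    have -> : a1 * (g1 (r * r) * r) - a2 * ((g2 (r * r) + om) * r) = 0 by lra.
    have -> : a2 * (g1 (r * r) * r) + a1 * ((g2 (r * r) + om) * r) = 0 by lra.
    by rewrite !mulr0 subr0.
(* [front_decay] is used with limit [(l1, l2) = (r, 0)]. *)
have rE : r * r + 0 * 0 = r * r by rewrite mulr0 addr0.
pose sg x := s x - (r * r + 0 * 0).
(* As [G] vanishes in the limit, the derivatives of [y * g1 y] and [y * (g2 y + om)] at [r * r]
   reduce to [- b] and [d]. *)
pose b := - (r * r * derive1 g1 (r * r)); pose d := r * r * derive1 g2 (r * r).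
have b0 : 0 < b by rewrite /b -mulrN mulr_gt0 // oppr_gt0.
have G1s e : 0 < e -> \forall x \near +oo_R, `|G1 x * s x + b * sg x| <= e * `|sg x|.
  move=> e0; have E : has_deriv (fun y => g1 y * y) (r * r) (- b).
    by apply: has_deriv_eq; [derive_rules; exact: g1' | rewrite /b G10; ring].
  have := has_deriv_expansion E sl e0; apply: filterS => x; rewrite G10 /sg rE.
  by rewrite (_ : _ - _ - _ = G1 x * s x + b * (s x - r * r)) //; rewrite /G1; ring.
have G2s e : 0 < e -> \forall x \near +oo_R, `|G2 x * s x - d * sg x| <= e * `|sg x|.
  move=> e0; have E : has_deriv (fun y => (g2 y + om) * y) (r * r) d.
    by apply: has_deriv_eq; [derive_rules; exact: g2' | rewrite /d addr0 G20; ring].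
  have := has_deriv_expansion E sl e0; apply: filterS => x; rewrite G20 /sg rE.
  by rewrite (_ : _ - _ - _ = G2 x * s x - d * (s x - r * r)) //; rewrite /G2; ring.
have rr0' : 0 < r * r + 0 * 0 by rewrite rE.
have [sgd w1d w2d] := front_decay a10 v1' v2' w1' w2' ode1 ode2 c0 b0 rr0' G1s G2s v1l v2l w10 w20.
have pd : exp_decay p.
  apply: exp_decayD.
    by apply: exp_decayM w1d => x; case: (HC x) => -[+ _ _ _] _; exact.
  by apply: exp_decayM w2d => x; case: (HC x) => -[_ + _ _] _; exact.
(* A differentiable function of [s] inherits the decay of [sg]; thus [G1] and [G2] decay although
   [v1] does not. *)
have Gd (g : R -> R) (m y : R) : has_deriv g (r * r) m -> y = g (r * r) ->
    exp_decay (fun x => g (s x) - y).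
  move=> gm ->; apply: (exp_decay_le (C := 1 + `|m|) sgd).
  have := has_deriv_expansion gm sl ltr01; apply: filterS => x; rewrite /sg rE.
  have -> : g (s x) - g (r * r) =
    (g (s x) - g (r * r) - m * (s x - r * r)) + m * (s x - r * r) by ring.
  rewrite addrK => h; rewrite (le_trans (ler_normD _ _)) // mulrDl normrM lerD //.
have G1d : exp_decay G1.
  have := Gd _ _ 0 (g1' _) (esym G10); congr exp_decay.
  by apply/funext => x; rewrite subr0.
have G2d : exp_decay G2.
  have E : - om = g2 (r * r) by apply/eqP; rewrite eq_sym -subr_eq0 opprK G20.
  have := Gd _ _ _ (g2' _) E; congr exp_decay.
  by apply/funext => x; rewrite opprK.
have vG (v G : R -> R) : (forall x, `|v x| <= C) -> exp_decay G -> exp_decay (fun x => G x * v x).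
  move=> vC Gd'; have := exp_decayM vC Gd'; congr exp_decay.
  by apply/funext => x; rewrite mulrC.
have v1b x : `|v1 x| <= C by case: (HC x) => -[+ _ _ _] _; exact.
have v2b x : `|v2 x| <= C by case: (HC x) => -[_ + _ _] _; exact.
have G1b x : `|G1 x| <= C by case: (HC x) => _ [+ _ _ _]; exact.
have G2b x : `|G2 x| <= C by case: (HC x) => _ [_ + _ _]; exact.
have dG1d : exp_decay dG1.
  apply: (exp_decayM (C := C)); last exact: exp_decay_cstM.
  by move=> x; case: (HC x) => _ [_ _ + _]; exact.
have dG2d : exp_decay dG2.
  apply: (exp_decayM (C := C)); last exact: exp_decay_cstM.
  by move=> x; case: (HC x) => _ [_ _ _ +]; exact.
split.
  split=> //; first exact: exp_decay_sub_lim v1' w1d v1l.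
  have := exp_decay_sub_lim v2' w2d v2l; congr exp_decay.
  by apply/funext => x; rewrite subr0.
apply: (higher_decay v1' v2' w1' w2' ode1 ode2 v1b v2b G1b G2b G1' G2' z1' z2' w1d w2d dG1d dG2d).
  by apply: exp_decayD; last apply: exp_decayN; exact: vG.
by apply: exp_decayD; exact: vG.
Qed.
(** The reflection of [x] moves the end to [+oo]: derivatives of odd order change sign, and the
    equation keeps its form with speed [- c]. [energy_decay] holds for speeds of either sign. *)
Lemma profile_decay_ninfty :
    v1 x @[x --> -oo] --> (0 : R) -> v2 x @[x --> -oo] --> (0 : R) ->
  [/\ exp_decay (fun x => v1 (- x)), exp_decay (fun x => v2 (- x)),
      exp_decay (fun x => w1 (- x)) & exp_decay (fun x => w2 (- x))] /\
  [/\ exp_decay (fun x => z1 (- x)), exp_decay (fun x => z2 (- x)),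
      exp_decay (fun x => t1 (- x)) & exp_decay (fun x => t2 (- x))].
Proof.
move=> /cvgNy_compNP v1l /cvgNy_compNP v2l; have [C HC] := bound.
pose V1 x := v1 (- x); pose V2 x := v2 (- x).
pose W1 x := - w1 (- x); pose W2 x := - w2 (- x).
pose Z1 x := z1 (- x); pose Z2 x := z2 (- x).
pose T1 x := - t1 (- x); pose T2 x := - t2 (- x).
pose K1 x := G1 (- x); pose K2 x := G2 (- x).
pose dK1 x := - dG1 (- x); pose dK2 x := - dG2 (- x).
have V1' x : has_deriv V1 x (W1 x) by exact: (has_deriv_flip (v1' (- x))).
have V2' x : has_deriv V2 x (W2 x) by exact: (has_deriv_flip (v2' (- x))).
have W1' x : has_deriv W1 x (Z1 x).
  by rewrite -[Z1 x]opprK; exact: (has_derivN (has_deriv_flip (w1' (- x)))).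
have W2' x : has_deriv W2 x (Z2 x).
  by rewrite -[Z2 x]opprK; exact: (has_derivN (has_deriv_flip (w2' (- x)))).
have Z1' x : has_deriv Z1 x (T1 x) by exact: (has_deriv_flip (z1' (- x))).
have Z2' x : has_deriv Z2 x (T2 x) by exact: (has_deriv_flip (z2' (- x))).
have K1' x : has_deriv K1 x (dK1 x) by exact: (has_deriv_flip (G1' (- x))).
have K2' x : has_deriv K2 x (dK2 x) by exact: (has_deriv_flip (G2' (- x))).
have Ode1 x : Z1 x = - (a1 * (- c * W1 x + (K1 x * V1 x - K2 x * V2 x))
    - a2 * (- c * W2 x + (K2 x * V1 x + K1 x * V2 x))).
  by rewrite /Z1 ode1 /W1 /W2 !mulrNN.
have Ode2 x : Z2 x = - (a2 * (- c * W1 x + (K1 x * V1 x - K2 x * V2 x))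
    + a1 * (- c * W2 x + (K2 x * V1 x + K1 x * V2 x))).
  by rewrite /Z2 ode2 /W1 /W2 !mulrNN.
have V1l : V1 x @[x --> +oo] --> (0 : R) by exact: v1l.
have V2l : V2 x @[x --> +oo] --> (0 : R) by exact: v2l.
have V1b x : `|V1 x| <= C by case: (HC (- x)) => -[+ _ _ _] _; exact.
have V2b x : `|V2 x| <= C by case: (HC (- x)) => -[_ + _ _] _; exact.
have K1b x : `|K1 x| <= C by case: (HC (- x)) => _ [+ _ _ _]; exact.
have K2b x : `|K2 x| <= C by case: (HC (- x)) => _ [_ + _ _]; exact.
have W1l : W1 x @[x --> +oo] --> (0 : R).
  by apply: (deriv_cvg0 V1' W1' _ V1l) => x; case: (HC (- x)) => -[_ _ + _] _; exact.
have W2l : W2 x @[x --> +oo] --> (0 : R).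
  by apply: (deriv_cvg0 V2' W2' _ V2l) => x; case: (HC (- x)) => -[_ _ _ +] _; exact.
have sl : s (- x) @[x --> +oo] --> (0 : R).
  have -> : 0 = 0 * 0 + 0 * 0 :> R by rewrite mulr0 addr0.
  by apply: cvgD; apply: cvgM.
have K1l : K1 x @[x --> +oo] --> g1 0.
  exact: (continuous_cvg _ (has_deriv_continuous (g1' _)) sl).
have g0 : 0 < - g1 0 / 2 by rewrite divr_gt0 // oppr_gt0.
(* Near the end [K1] lies below half of its negative limit [g1 0]. *)
have K1g : \forall x \near +oo_R, K1 x <= - (- g1 0 / 2).
  have P := cvgr_dist_le _ _ K1l _ g0; near=> x.
  have /ler_normlP[+ _] : `|g1 0 - K1 x| <= - g1 0 / 2 by near: x; exact: P.
  lra.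
have sq (u : R) : 0 <= u * u by rewrite -expr2 sqr_ge0.
have Nd := energy_decay a10 V1' V2' W1' W2' Ode1 Ode2 g0 K1b K2b K1g V1l V2l W1l W2l.
have dom (f : R -> R) :
    (forall x, f x * f x <= V1 x * V1 x + V2 x * V2 x + W1 x * W1 x + W2 x * W2 x) ->
    exp_decay f.
  by move=> fN; apply: (exp_decay_sqrt Nd); exact: nearW.
have [V1d V2d W1d W2d] :
    [/\ exp_decay V1, exp_decay V2, exp_decay W1 & exp_decay W2].
  split; apply: dom => x;
    by have := (sq (V1 x), sq (V2 x), sq (W1 x), sq (W2 x)); case=> -[[]]; lra.
have unN (f : R -> R) : exp_decay (fun x => - f (- x)) -> exp_decay (fun x => f (- x)).
  move=> /exp_decayN; congr exp_decay.
  by apply/funext => x; rewrite opprK.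
have w1d := unN _ W1d; have w2d := unN _ W2d.
have pd : exp_decay (fun x => p (- x)).
  by apply: exp_decayD; [exact: exp_decayM V1b w1d | exact: exp_decayM V2b w2d].
have dK1d : exp_decay dK1.
  apply: exp_decayN; apply: (exp_decayM (C := C) (f := fun x => derive1 g1 (s (- x)))).
    by move=> x; case: (HC (- x)) => _ [_ _ + _]; exact.
  exact: exp_decay_cstM.
have dK2d : exp_decay dK2.
  apply: exp_decayN; apply: (exp_decayM (C := C) (f := fun x => derive1 g2 (s (- x)))).
    by move=> x; case: (HC (- x)) => _ [_ _ _ +]; exact.
  exact: exp_decay_cstM.
have [||Z1d Z2d T1d T2d] := higher_decay V1' V2' W1' W2' Ode1 Ode2
  V1b V2b K1b K2b K1' K2' Z1' Z2' W1d W2d dK1d dK2d.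
- by apply: exp_decayD; [exact: exp_decayM K1b V1d | apply: exp_decayN; exact: exp_decayM K2b V2d].
- by apply: exp_decayD; [exact: exp_decayM K2b V1d | exact: exp_decayM K1b V2d].
split; split; [exact: V1d | exact: V2d | exact: w1d | exact: w2d
  | exact: Z1d | exact: Z2d | exact: (unN _ T1d) | exact: (unN _ T2d)].
Unshelve. all: by end_near. Qed.
End ScalarFront.

(** * Vectors in the plane *)

Section Plane.
Variable R : realType.
Implicit Types (u : 'cV[R]_2) (U : R -> 'cV[R]_2) (a b : R).

Lemma cplx_mx_mul0 a b u : (cplx_mx a b *m u) 0 0 = a * u 0 0 - b * u 1 0.
Proof.
rewrite mxE !big_ord_recl big_ord0 !mxE /= addr0 mulNr.
by congr (_ - _ * u _ _); apply/val_inj.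
Qed.

Lemma cplx_mx_mul1 a b u : (cplx_mx a b *m u) 1 0 = b * u 0 0 + a * u 1 0.
Proof.
rewrite mxE !big_ord_recl big_ord0 !mxE /= addr0.
by congr (_ + _ * u _ _); apply/val_inj.
Qed.

Lemma sqr_enorm u : enorm u ^+ 2 = u 0 0 * u 0 0 + u 1 0 * u 1 0.
Proof.
rewrite sqr_sqrtr; last by apply: sumr_ge0 => i _; exact: sqr_ge0.
by rewrite !big_ord_recl big_ord0 addr0 !expr2; congr (_ + u _ _ * u _ _); apply/val_inj.
Qed.

Lemma enorm_ge0 n (u : 'cV[R]_n) : 0 <= enorm u.
Proof. exact: sqrtr_ge0. Qed.

Lemma enorm_le u : enorm u <= `|u 0 0| + `|u 1 0|.
Proof.
rewrite -(@ler_pXn2r _ 2) ?nnegrE ?enorm_ge0 ?addr_ge0 // sqr_enorm.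
have N2 (t : R) : t * t = `|t| * `|t| by rewrite -normrM ger0_norm // -expr2 sqr_ge0.
rewrite (N2 (u 0 0)) (N2 (u 1 0)) sqrrD expr2 [X in _ <= _ + X]expr2 lerD2r.
by rewrite lerDl mulrn_wge0 // mulr_ge0.
Qed.

Lemma exp_decay_enorm U : exp_decay (fun x => U x 0 0) ->
  exp_decay (fun x => U x 1 0) -> exp_decay (fun x => enorm (U x)).
Proof.
move=> /exp_decay_norm U0 /exp_decay_norm U1.
apply: (exp_decay_le (C := 1) (exp_decayD U0 U1)); apply: nearW => x.
by rewrite mul1r ger0_norm ?enorm_ge0 // (le_trans (enorm_le _)) // ler_norm.
Qed.

Lemma enorm_bounded U : bounded_fun U -> exists M, forall x, enorm (U x) <= M.
Proof.
move=> /bounded_funP[M UM]; exists (M + M) => x.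
have /mx_norm_le UxM := UM x.
by rewrite (le_trans (enorm_le _)) // lerD.
Qed.

End Plane.

(** * From the front to its profile equation, and the theorem *)

Lemma derive1n_mx (R : realType) k m n (f : R -> 'M[R]_(m.+1, n.+1)) i j :
  Ckb k f -> derive1n k (fun x => f x i j) = fun x => derive1n k f x i j.
Proof.
elim: k f => [//|k IHk] f /CkbS[_ f0 fk].
rewrite !derive1Sn -IHk //; congr derive1n; apply/funext => x.
by rewrite derive1_mx.
Qed.

(* At time [0] the rotation is trivial and the moving frame is at rest, so the
   equation there is the profile equation. *)
Lemma profile_equation (R : realType) (al1 al2 c om : R) (g1 g2 : R -> R)
    (v : R -> 'cV[R]_2) : Ckb 2 v ->
    is_solution (cplx_mx al1 al2) (nonlin g1 g2)
      (fun x t => rot (- (om * t)) *m v (x - c * t)) ->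
  let v1 x := v x 0 0 in let v2 x := v x 1 0 in
  let s x := v1 x * v1 x + v2 x * v2 x in
  forall x,
  al1 * derive1 (derive1 v1) x - al2 * derive1 (derive1 v2) x =
    - (c * derive1 v1 x + (g1 (s x) * v1 x - (g2 (s x) + om) * v2 x)) /\
  al2 * derive1 (derive1 v1) x + al1 * derive1 (derive1 v2) x =
    - (c * derive1 v2 x + ((g2 (s x) + om) * v1 x + g1 (s x) * v2 x)).
Proof.
move=> v2C sol v1 v2 s x; have [ut _ _ E] := sol x 0 (lexx 0).
have v1C : Ckb 2 v1 by exact: (Ckb_mx _ _).1 v2C 0 0.
have v2C' : Ckb 2 v2 by exact: (Ckb_mx _ _).1 v2C 1 0.
have u0 : (fun y => rot (- (om * 0)) *m v (y - c * 0)) = v.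
  apply/funext => y; rewrite !mulr0 subr0 oppr0; apply/colP => i.
  have : i = 0 \/ i = 1 by case: i => [[|[|//]]] ?; [left|right]; apply/val_inj.
  by move=> [->|->]; rewrite ?(cplx_mx_mul0, cplx_mx_mul1) cos0 sin0 !(mul0r, mul1r) ?subr0 ?add0r.
rewrite u0 in E.
have d2 (i : 'I_2) : derive1 (derive1 (fun y => v y i 0)) x = derive1n 2 v x i 0.
  by have := derive1n_mx i 0 v2C => /(congr1 (@^~ x)).
have shift (f : R -> R) : Ckb 2 f ->
    has_deriv (fun t => f (x - c * t)) 0 (derive1 f x * - c).
  move=> fC; apply: (has_deriv_comp (g := fun t => x - c * t)).
    by rewrite mulr0 subr0; exact: (Ckb_has_deriv fC).
  by derive_ring.
have lin : has_deriv (fun t => - (om * t)) 0 (- om) by derive_ring.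
have cosd : has_deriv (fun t => cos (- (om * t))) 0 0.
  apply: has_deriv_eq.
    by apply: (has_deriv_comp (f := cos) _ lin); exact: is_derive_cos.
  by rewrite mulr0 oppr0 sin0 oppr0 mul0r.
have sind : has_deriv (fun t => sin (- (om * t))) 0 (- om).
  apply: has_deriv_eq.
    by apply: (has_deriv_comp (f := sin) _ lin); exact: is_derive_sin.
  by rewrite mulr0 oppr0 cos0 mul1r.
have v1s := shift _ v1C; have v2s := shift _ v2C'.
have E0 := congr1 (fun M : 'cV[R]_2 => M 0 0) E.
have E1 := congr1 (fun M : 'cV[R]_2 => M 1 0) E.
rewrite /= derive1_mx // in E0; rewrite /= derive1_mx // in E1.
(* The time derivative at [0] is [- c v' - i om v]; here its real part, in [D1] its imaginary
   part. *)
have D0 : derive1 (fun t => (rot (- (om * t)) *m v (x - c * t)) 0 0) 0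
    = - (c * derive1 v1 x) + om * v2 x.
  apply: has_deriv_val.
  rewrite (_ : (fun t => _) = fun t => cos (- (om * t)) * v1 (x - c * t)
     - sin (- (om * t)) * v2 (x - c * t)); last first.
    by apply/funext => t; rewrite cplx_mx_mul0.
  apply: has_deriv_eq; first by derive_rules.
  by cbv beta; rewrite !mulr0 oppr0 cos0 sin0 addr0; ring.
have D1 : derive1 (fun t => (rot (- (om * t)) *m v (x - c * t)) 1 0) 0
    = - (c * derive1 v2 x) - om * v1 x.
  apply: has_deriv_val.
  rewrite (_ : (fun t => _) = fun t => sin (- (om * t)) * v1 (x - c * t)
     + cos (- (om * t)) * v2 (x - c * t)); last first.
    by apply/funext => t; rewrite cplx_mx_mul1.
  apply: has_deriv_eq; first by derive_rules.
  by cbv beta; rewrite !mulr0 oppr0 cos0 sin0 addr0; ring.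
have ux0 : rot (- (om * 0)) *m v (x - c * 0) = v x by exact: (congr1 (@^~ x) u0).
rewrite D0 ux0 mxE cplx_mx_mul0 /nonlin /gmx cplx_mx_mul0 sqr_enorm -!d2 in E0.
rewrite D1 ux0 mxE cplx_mx_mul1 /nonlin /gmx cplx_mx_mul1 sqr_enorm -!d2 in E1.
(* The same equations up to conversion, in terms of [v1], [v2] and [s]. *)
have {}E0 : - (c * derive1 v1 x) + om * v2 x =
    al1 * derive1 (derive1 v1) x - al2 * derive1 (derive1 v2) x
    + (g1 (s x) * v1 x - g2 (s x) * v2 x) := E0.
have {}E1 : - (c * derive1 v2 x) - om * v1 x =
    al2 * derive1 (derive1 v1) x + al1 * derive1 (derive1 v2) x
    + (g2 (s x) * v1 x + g1 (s x) * v2 x) := E1.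
split.
- rewrite (_ : al1 * _ - _ = - (c * derive1 v1 x) + om * v2 x
      - (g1 (s x) * v1 x - g2 (s x) * v2 x)); first by ring.
  by rewrite E0 addrK.
- rewrite (_ : al2 * _ + _ = - (c * derive1 v2 x) - om * v1 x
      - (g2 (s x) * v1 x + g1 (s x) * v2 x)); first by ring.
  by rewrite E1 addrK.
Qed.

(* [x + i y = (alpha1 + i alpha2) ^ -1 * (alpha1 + i alpha2) * (x + i y)] *)
Lemma cplx_div_mul (R : realType) (alpha1 alpha2 x y : R) :
    let aa := alpha1 * alpha1 + alpha2 * alpha2 in aa != 0 ->
  let p := alpha1 * x - alpha2 * y in let q := alpha2 * x + alpha1 * y in
  x = - (alpha1 / aa * - p - - alpha2 / aa * - q) /\
  y = - (- alpha2 / aa * - p + alpha1 / aa * - q).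
Proof. by move=> aa aa0 p q; rewrite /p /q /aa; split; field. Qed.

Theorem theorem2p2 (R : realType) (alpha1 alpha2 : R) (g1 g2 : R -> R)
    (v : R -> 'cV[R]_2) (c omega : R) (vinf : 'cV[R]_2) :
  0 < alpha1 ->
  Ck 3 (gmx g1 g2) ->
  g1 0 < 0 ->
  traveling_oscillating_front (cplx_mx alpha1 alpha2) (nonlin g1 g2)
    v c omega vinf ->
  Ckb 2 v ->
  0 < c ->
  vinf = \col_(i < 2) (if i == 0 then enorm vinf else 0) ->
  derive1 g1 (enorm vinf ^+ 2) < 0 ->
  Ckb 5 v /\
  exists K mu : R,
    [/\ 0 < K,
        0 < mu,
        forall x : R, 0 <= x ->
          enorm (v x - vinf) + enorm (derive1 v x) + enorm (derive1n 2 v x)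
            + enorm (derive1n 3 v x) <= K * expR (- mu * x) &
        forall x : R, x <= 0 ->
          enorm (v x) + enorm (derive1 v x) + enorm (derive1n 2 v x)
            + enorm (derive1n 3 v x) <= K * expR (mu * x)].
Proof.
move=> al0 gC g10 [sol vNy vy vinf0] vC c0 vinfE dg1.
pose v1 x := v x 0 0; pose v2 x := v x 1 0; pose r := enorm vinf.
(* [a1 + i a2] is the inverse of [alpha], and [a1] inherits the sign of [alpha1]. *)
pose aa : R := alpha1 * alpha1 + alpha2 * alpha2.
pose a1 := alpha1 / aa; pose a2 := - alpha2 / aa.
have aa0 : 0 < aa by rewrite ltr_pwDl ?mulr_gt0 // -expr2 sqr_ge0.
have a10 : 0 < a1 by rewrite divr_gt0.
have v1C : Ckb 2 v1 by exact: (Ckb_mx _ _).1 vC 0 0.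
have v2C : Ckb 2 v2 by exact: (Ckb_mx _ _).1 vC 1 0.
have g1C : Ck 3 g1.
  rewrite (_ : g1 = fun x => gmx g1 g2 x 0 0); first exact: Ck_mx.
  by apply/funext => x; rewrite mxE.
have g2C : Ck 3 g2.
  rewrite (_ : g2 = fun x => gmx g1 g2 x 1 0); first exact: Ck_mx.
  by apply/funext => x; rewrite mxE.
have eqn := profile_equation vC sol.
pose s x := v1 x * v1 x + v2 x * v2 x.
pose F1 x := c * derive1 v1 x + (g1 (s x) * v1 x - (g2 (s x) + omega) * v2 x).
pose F2 x := c * derive1 v2 x + ((g2 (s x) + omega) * v1 x + g1 (s x) * v2 x).
have FE x : F1 x = - (alpha1 * derive1 (derive1 v1) x - alpha2 * derive1 (derive1 v2) x)
    /\ F2 x = - (alpha2 * derive1 (derive1 v1) x + alpha1 * derive1 (derive1 v2) x).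
  by have [-> ->] := eqn x; rewrite !opprK.
have aaN0 : aa != 0 by rewrite gt_eqF.
have ode1 x : derive1 (derive1 v1) x = - (a1 * F1 x - a2 * F2 x).
  by have [-> ->] := FE x; exact: (cplx_div_mul _ _ aaN0).1.
have ode2 x : derive1 (derive1 v2) x = - (a2 * F1 x + a1 * F2 x).
  by have [-> ->] := FE x; exact: (cplx_div_mul _ _ aaN0).2.
have [v1C5 v2C5] := Ckb_profile g1C g2C v1C v2C ode1 ode2.
have two (i : 'I_2) : i = 0 \/ i = 1.
  by case: i => [[|[|//]]] ?; [left|right]; apply/val_inj.
have vC5 : Ckb 5 v.
  by apply/Ckb_mx => i j; rewrite (ord1 j); case: (two i) => ->.
split=> //.
have vinf_0 : vinf 0 0 = r by rewrite vinfE mxE.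
have vinf_1 : vinf 1 0 = 0 by rewrite vinfE mxE.
have r0 : r != 0.
  apply: contra_neq vinf0 => r0; apply/colP => i; rewrite mxE.
  by case: (two i) => ->; rewrite ?vinf_0 ?vinf_1.
have coordl (F : set_system R) (l : 'cV[R]_2) (i : 'I_2) : Filter F ->
    v x @[x --> F] --> l -> v x i 0 @[x --> F] --> l i 0.
  by move=> FF vl; apply: (continuous_cvg _ (@coord_continuous _ _ _ i 0 l) vl).
have v1y : v1 x @[x --> +oo] --> r by rewrite -vinf_0; exact: coordl.
have v2y : v2 x @[x --> +oo] --> (0 : R) by rewrite -vinf_1; exact: coordl.
have v1Ny : v1 x @[x --> -oo] --> (0 : R).
  by have := coordl _ _ 0 _ vNy; rewrite mxE; apply.
have v2Ny : v2 x @[x --> -oo] --> (0 : R).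
  by have := coordl _ _ 1 _ vNy; rewrite mxE; apply.
rewrite expr2 in dg1.
have [[dp0 dp1 dp2 dp3] [dp4 dp5 dp6 dp7]] :=
  profile_decay_pinfty a10 c0 g1C g2C v1C v2C ode1 ode2 r0 dg1 v1y v2y.
have [[dn0 dn1 dn2 dn3] [dn4 dn5 dn6 dn7]] :=
  profile_decay_ninfty a10 g1C g2C g10 v1C v2C ode1 ode2 v1Ny v2Ny.
have coordE k i : (k <= 5)%N ->
    (fun x => derive1n k v x i 0) = derive1n k (fun x => v x i 0).
  by move=> k5; rewrite (derive1n_mx i 0 (Ckb_le k5 vC5)).
have decayp k : (k <= 5)%N -> exp_decay (derive1n k v1) -> exp_decay (derive1n k v2) ->
    exp_decay (fun x => enorm (derive1n k v x)).
  by move=> k5 h1 h2; apply: exp_decay_enorm; rewrite coordE.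
have decayn k : (k <= 5)%N -> exp_decay (fun x => derive1n k v1 (- x)) ->
    exp_decay (fun x => derive1n k v2 (- x)) ->
    exp_decay (fun x => enorm (derive1n k v (- x))).
  move=> k5 h1 h2; apply: exp_decay_enorm.
    by have /funeqP E := coordE k 0 k5; under eq_fun do rewrite E.
  by have /funeqP E := coordE k 1 k5; under eq_fun do rewrite E.
pose S x := enorm (v x - vinf) + enorm (derive1 v x) + enorm (derive1n 2 v x)
  + enorm (derive1n 3 v x).
pose T x := enorm (v x) + enorm (derive1 v x) + enorm (derive1n 2 v x)
  + enorm (derive1n 3 v x).
have S0 x : 0 <= S x by rewrite /S !addr_ge0 // enorm_ge0.
have T0 x : 0 <= T x by rewrite /T !addr_ge0 // enorm_ge0.
have Sd : exp_decay S.
  apply: exp_decayD; [apply: exp_decayD; [apply: exp_decayD|]|].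
  - apply: exp_decay_enorm.
      by under eq_fun do rewrite !mxE vinf_0.
    by under eq_fun do rewrite !mxE vinf_1 subr0.
  - exact: (decayp 1%N isT dp2 dp3).
  - exact: (decayp 2%N isT dp4 dp5).
  - exact: (decayp 3%N isT dp6 dp7).
have Td : exp_decay (fun x => T (- x)).
  apply: exp_decayD; [apply: exp_decayD; [apply: exp_decayD|]|].
  - exact: (decayn 0%N isT dn0 dn1).
  - exact: (decayn 1%N isT dn2 dn3).
  - exact: (decayn 2%N isT dn4 dn5).
  - exact: (decayn 3%N isT dn6 dn7).
have vb k : (k <= 5)%N -> exists M, forall x, enorm (derive1n k v x) <= M.
  by move=> k5; apply: enorm_bounded; case: vC5 => _; exact.
have [M0 HM0] := vb 0%N isT; have [M1 HM1] := vb 1%N isT.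
have [M2 HM2] := vb 2%N isT; have [M3 HM3] := vb 3%N isT.
have [M HM] : exists M, forall x, enorm (v x - vinf) <= M.
  have [C HC] := Ckb_bounded vC5; apply: enorm_bounded; apply/bounded_funP.
  by exists (C + `|vinf|) => x; rewrite (le_trans (ler_normB _ _)) // lerD.
(* Treating [S x + T (- x)] as one function gives common constants [K] and [mu]; each estimate
   follows because the other summand is nonnegative. *)
have STb x : `|S x + T (- x)| <= M + M1 + M2 + M3 + (M0 + M1 + M2 + M3).
  rewrite ger0_norm; last exact: addr_ge0.
  exact: lerD (lerD (lerD (lerD (HM x) (HM1 x)) (HM2 x)) (HM3 x))
    (lerD (lerD (lerD (HM0 (- x)) (HM1 (- x))) (HM2 (- x))) (HM3 (- x))).
have [K [mu [K0 mu0 H]]] := exp_decay_global (exp_decayD Sd Td) STb.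
exists K, mu; split=> // x x0.
- have h := le_trans (ler_norm _) (H x x0).
  by apply: (le_trans _ h); rewrite -[leLHS]/(S x) lerDl.
- have xN : 0 <= - x by rewrite oppr_ge0.
  have := le_trans (ler_norm _) (H _ xN); rewrite mulrNN opprK => h.
  by apply: (le_trans _ h); rewrite -[leLHS]/(T x) lerDr.
Qed.
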